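(* Let $f\colon\mathfrak B_d\to\mathfrak B_d$ be an nc function without fixed points. Then for every $0<r<1$ the sequence of iterates $f^{\circ n}=f\circ\cdots\circ f$ ($n$ times) converges uniformly on the subball $r\overline{\mathfrak B_d}$ to the constant function $\zeta$, where $\zeta\in\partial\mathbb B_d$ is the Denjoy–Wolff point of $f_1=f|_{\mathfrak B_d(1)}$.
   Context: $\mathbb M_d=\bigsqcup_{n\ge1}M_n(\mathbb C)^d$. The row ball is $\mathfrak B_d=\bigsqcup_n\mathfrak B_d(n)$, $\mathfrak B_d(n)=\{X\in M_n(\mathbb C)^d:\ \|X\|:=\|\sum_jX_jX_j^*\|^{1/2}<1\}$; $\mathbb B_d=\mathfrak B_d(1)$ is the open Euclidean unit ball of $\mathbb C^d$, and $r\overline{\mathfrak B_d}=\bigsqcup_n\{X\in M_n(\mathbb C)^d:\|X\|\le r\}$. Uniform convergence on $r\overline{\mathfrak B_d}$ means uniformly over all points of all levels $n$, with respect to the norm $\|\cdot\|$. An nc function $f\colon\mathfrak B_d\to\mathfrak B_d$ is a map with $f(\mathfrak B_d(n))\subset\mathfrak B_d(n)$ for all $n$, $f(X\oplus Y)=f(X)\oplus f(Y)$, and $f(S^{-1}XS)=S^{-1}f(X)S$ whenever $X,S^{-1}XS\in\mathfrak B_d(n)$, $S\in GL_n(\mathbb C)$. ''Without fixed points'' means $f(X)\ne X$ for all $X$ in all levels. The constant function $\zeta\in\mathbb C^d$ sends $X$ at level $n$ to $\zeta\otimes I_n=(\zeta_1I_n,\dots,\zeta_dI_n)$. The Denjoy–Wolff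 point of the fixed-point-free holomorphic self-map $f_1$ of $\mathbb B_d$ is the unique point $\zeta\in\partial\mathbb B_d$ such that $f_1^{\circ n}\to\zeta$ uniformly on compact subsets of $\mathbb B_d$ (it exists by the classical Denjoy–Wolff theorem for the ball). *)

(* Defs.v *)
From mathcomp Require Import all_boot all_order all_algebra.
From mathcomp Require Import sesquilinear spectral.
From mathcomp Require Import complex.
From mathcomp Require Import all_classical all_reals all_analysis.

Set Implicit Arguments.
Unset Strict Implicit.
Unset Printing Implicit Defensive.

Import Order.TTheory GRing.Theory Num.Theory.
Import numFieldNormedType.Exports.

Local Open Scope ring_scope.
Local Open Scope classical_set_scope.
Local Open Scope sesquilinear_scope.

(* The complex numbers over [R].  Going through the bundled structure, rather
   than the bare type [R[i]], makes the topologies on the scalars and on the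
   spaces of matrices available. *)
Definition Cplx (R : realType) : numClosedFieldType := R[i]%C.

(* The modulus, as an element of [R] (the norm [`|z|] lives in [R[i]]). *)
Definition modulus (R : realType) (z : Cplx R) : R := Normc.normc z.

Definition l2norm (R : realType) (n : nat) (v : 'cV[Cplx R]_n) : R :=
  Num.sqrt (\sum_i modulus (v i 0) ^+ 2).

Definition opnorm (R : realType) (n : nat) (A : 'M[Cplx R]_n) : R :=
  sup [set l2norm (A *m v) | v in [set v : 'cV[Cplx R]_n | l2norm v <= 1]].

(* M_n(C)^d *)
Definition mxtuple (R : realType) (d n : nat) : Type :=
  {ffun 'I_d -> 'M[Cplx R]_n}.

Definition rownorm (R : realType) (d n : nat) (X : mxtuple R d n) : R :=
  Num.sqrt (opnorm (\sum_j X j *m (X j)^t*)).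

(* Levels are indexed by all of [nat], so the condition [0 < n] is what leaves
   out the (one-point) level of 0 x 0 matrices. *)
Definition rowball (R : realType) (d n : nat) : set (mxtuple R d n) :=
  [set X | (0 < n)%N /\ rownorm X < 1].

Definition closed_rowball (R : realType) (r : R) (d n : nat) :
    set (mxtuple R d n) :=
  [set X | (0 < n)%N /\ rownorm X <= r].

Definition dsum (R : realType) (d m n : nat)
    (X : mxtuple R d m) (Y : mxtuple R d n) : mxtuple R d (m + n) :=
  [ffun j => block_mx (X j) 0 0 (Y j)].

Definition similar_tuple (R : realType) (d n : nat) (S : 'M[Cplx R]_n)
    (X : mxtuple R d n) : mxtuple R d n :=
  [ffun j => invmx S *m X j *m S].

(* Graded maps are total on M_d; the predicates below only constrain their
   values on the row ball. *)
Definition graded_map (R : realType) (d : nat) : Type :=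
  forall n, mxtuple R d n -> mxtuple R d n.

Definition nc_selfmap (R : realType) (d : nat) (f : graded_map R d) : Prop :=
  [/\ forall n (X : mxtuple R d n), rowball X -> rowball (f n X),
      forall m n (X : mxtuple R d m) (Y : mxtuple R d n),
        rowball X -> rowball Y ->
        f (m + n)%N (dsum X Y) = dsum (f m X) (f n Y)
    & forall n (S : 'M[Cplx R]_n) (X : mxtuple R d n),
        S \in unitmx -> rowball X -> rowball (similar_tuple S X) ->
        f n (similar_tuple S X) = similar_tuple S (f n X)].

Definition fixed_point_free (R : realType) (d : nat) (f : graded_map R d) :
    Prop :=
  forall n (X : mxtuple R d n), rowball X -> f n X <> X.

(* z (x) I_n *)
Definition const_tuple (R : realType) (d : nat) (z : 'cV[Cplx R]_d) (n : nat) :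
    mxtuple R d n :=
  [ffun j => (z j 0)%:M].

(* [f] at level 1, with M_1(C)^d identified with C^d. *)
Definition level1 (R : realType) (d : nat) (f : graded_map R d)
    (z : 'cV[Cplx R]_d) : 'cV[Cplx R]_d :=
  \col_j f 1%N (const_tuple z 1) j 0 0.

Definition unit_ball (R : realType) (d : nat) : set 'cV[Cplx R]_d :=
  [set z | l2norm z < 1].

Definition unit_sphere (R : realType) (d : nat) : set 'cV[Cplx R]_d :=
  [set z | l2norm z = 1].

Definition iterates_cvg_compact (R : realType) (d : nat)
    (g : 'cV[Cplx R]_d -> 'cV[Cplx R]_d) (zeta : 'cV[Cplx R]_d) : Prop :=
  forall K : set 'cV[Cplx R]_d, compact K -> K `<=` @unit_ball R d ->
  forall eps : R, 0 < eps ->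
  exists N : nat, forall k : nat, (N <= k)%N ->
  forall z, K z -> l2norm (iter k g z - zeta) < eps.

Definition Denjoy_Wolff_point (R : realType) (d : nat)
    (g : 'cV[Cplx R]_d -> 'cV[Cplx R]_d) (zeta : 'cV[Cplx R]_d) : Prop :=
  unique (fun x => @unit_sphere R d x /\ iterates_cvg_compact g x) zeta.

(* One [N] serves all levels [n] at once. *)
Definition iterates_cvg_subball (R : realType) (d : nat) (f : graded_map R d)
    (zeta : 'cV[Cplx R]_d) (r : R) : Prop :=
  forall eps : R, 0 < eps ->
  exists N : nat, forall k : nat, (N <= k)%N ->
  forall n (X : mxtuple R d n), closed_rowball r X ->
  rownorm (iter k (f n) X - const_tuple zeta n) < eps.

(* Main.v *)
Require Import Defs.
From mathcomp Require Import all_boot all_order all_algebra.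
From mathcomp Require Import sesquilinear spectral complex ring lra.
From mathcomp Require Import all_classical all_reals all_analysis.

Set Implicit Arguments.
Unset Strict Implicit.
Unset Printing Implicit Defensive.

Import Order.TTheory GRing.Theory Num.Theory.
Import numFieldNormedType.Exports.

Local Open Scope ring_scope.
Local Open Scope classical_set_scope.
Local Open Scope sesquilinear_scope.

(* Conjugating the direct sum of [X] and a scalar point [w] by a unipotent matrix gives
   the block upper triangular point with diagonal [X], [w] and corner [X v - v w]; since
   [f] maps it to the point with diagonal [f X], [f w] and corner [f X v - v f w], the
   requirement that the latter be in the row ball is a Schwarz-Pick inequality. At level 1
   it says that [f] does not increase [kerq z w = |1 - <z,w>|^2 / ((1-|z|^2)(1-|w|^2))],
   the squared hyperbolic cosine of the distance in the ball.

   Let [a n] be the orbit of 0 at level 1. If it returns infinitely often to a compact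
   part of the ball, it stays in one (Calka), and an asymptotic centre argument yields a
   fixed point; hence [|a n|] tends to 1. Comparing [a j] with [a n] for times [n] at which
   [|a n|] is a record shows that [|a j - a n|^2 <= 2 sqrt (1 - |a j|^2)], so that the orbit
   converges to a point [zeta] of the sphere (Karlsson). Finally the Schwarz-Pick inequality
   between [X] and 0, applied to the iterates, puts the [k]-th iterate of [X] within a
   distance of [a k] controlled by [r] and [1 - |a k|^2] only. *)

(** * Real and imaginary parts of the scalars *)

Definition re (R : realType) (z : Cplx R) : R := complex.Re z.
Definition im (R : realType) (z : Cplx R) : R := complex.Im z.
Definition cof (R : realType) (a b : R) : Cplx R := (a +i* b)%C.
Definition abs2 (R : realType) (z : Cplx R) : R := re z ^+ 2 + im z ^+ 2.

Lemma cplxP (R : realType) (z w : Cplx R) : re z = re w -> im z = im w -> z = w.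
Proof. by case: z => a b; case: w => c e /= ; rewrite /re /im /= => -> ->. Qed.
Lemma reD (R : realType) (z w : Cplx R) : re (z + w) = re z + re w.
Proof. by case: z => a b; case: w. Qed.
Lemma imD (R : realType) (z w : Cplx R) : im (z + w) = im z + im w.
Proof. by case: z => a b; case: w. Qed.
Lemma reN (R : realType) (z : Cplx R) : re (- z) = - re z.
Proof. by case: z. Qed.
Lemma imN (R : realType) (z : Cplx R) : im (- z) = - im z.
Proof. by case: z. Qed.
Lemma reM (R : realType) (z w : Cplx R) : re (z * w) = re z * re w - im z * im w.
Proof. by case: z => a b; case: w. Qed.
Lemma imM (R : realType) (z w : Cplx R) : im (z * w) = re z * im w + im z * re w.
Proof. by case: z => a b; case: w. Qed.
Lemma conjE (R : realType) (z : Cplx R) : Num.conj z = conjc z.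
Proof. by []. Qed.
Lemma reJ (R : realType) (z : Cplx R) : re (Num.conj z) = re z.
Proof. by rewrite conjE; case: z. Qed.
Lemma imJ (R : realType) (z : Cplx R) : im (Num.conj z) = - im z.
Proof. by rewrite conjE; case: z. Qed.
Lemma re0 (R : realType) : re (0 : Cplx R) = 0. Proof. by []. Qed.
Lemma im0 (R : realType) : im (0 : Cplx R) = 0. Proof. by []. Qed.
Lemma re1 (R : realType) : re (1 : Cplx R) = 1. Proof. by []. Qed.
Lemma im1 (R : realType) : im (1 : Cplx R) = 0. Proof. by []. Qed.
Lemma re_cof (R : realType) (a b : R) : re (cof a b) = a. Proof. by []. Qed.
Lemma im_cof (R : realType) (a b : R) : im (cof a b) = b. Proof. by []. Qed.

(** Pushes [re] and [im] to the leaves, so that identities between scalars become real polynomial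
    ones for [ring], [field] and [lra]. *)
Definition cE := (reD, imD, reN, imN, reM, imM, reJ, imJ, re0, im0, re1, im1, re_cof, im_cof).

Lemma re_sum (R : realType) (I : finType) (F : I -> Cplx R) :
  re (\sum_i F i) = \sum_i re (F i).
Proof. exact: (big_morph _ (@reD R) (@re0 R)). Qed.

Lemma modulus_sqr (R : realType) (z : Cplx R) : modulus z ^+ 2 = abs2 z.
Proof.
case: z => a b; rewrite /modulus /= sqr_sqrtr //.
by rewrite addr_ge0 ?sqr_ge0.
Qed.

Lemma abs2_ge0 (R : realType) (z : Cplx R) : 0 <= abs2 z.
Proof. by rewrite addr_ge0 ?sqr_ge0. Qed.

Lemma abs2_eq0 (R : realType) (z : Cplx R) : abs2 z = 0 -> z = 0.
Proof.
move/eqP; rewrite paddr_eq0 ?sqr_ge0 // !sqrf_eq0 => /andP[/eqP a /eqP b].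
exact: cplxP.
Qed.

(** * The Hermitian inner product and the squared norm of columns *)

Definition hdot (R : realType) (n : nat) (u v : 'cV[Cplx R]_n) : Cplx R :=
  (v^t* *m u) 0 0.

Definition norm2 (R : realType) (n : nat) (u : 'cV[Cplx R]_n) : R := re (hdot u u).

Lemma hdotE (R : realType) (n : nat) (u v : 'cV[Cplx R]_n) :
  hdot u v = \sum_i u i 0 * Num.conj (v i 0).
Proof. by rewrite /hdot mxE; apply: eq_bigr => i _; rewrite !mxE mulrC. Qed.

Lemma norm2E (R : realType) (n : nat) (u : 'cV[Cplx R]_n) :
  norm2 u = \sum_i abs2 (u i 0).
Proof.
rewrite /norm2 hdotE re_sum; apply: eq_bigr => i _.
by rewrite /abs2 !cE; ring.
Qed.

Lemma l2normE (R : realType) (n : nat) (u : 'cV[Cplx R]_n) :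
  l2norm u = Num.sqrt (norm2 u).
Proof.
by rewrite /l2norm norm2E; congr Num.sqrt; apply: eq_bigr => i _; rewrite modulus_sqr.
Qed.

Lemma norm2_ge0 (R : realType) (n : nat) (u : 'cV[Cplx R]_n) : 0 <= norm2 u.
Proof. by rewrite norm2E sumr_ge0 // => i _; exact: abs2_ge0. Qed.

Lemma norm2_eq0 (R : realType) (n : nat) (u : 'cV[Cplx R]_n) : norm2 u = 0 -> u = 0.
Proof.
rewrite norm2E => /eqP; rewrite psumr_eq0 => [|i _]; last exact: abs2_ge0.
move=> /allP h; apply/matrixP => i j; rewrite ord1 mxE.
by apply: abs2_eq0; apply/eqP/(h i); rewrite mem_index_enum.
Qed.

Lemma hdotC (R : realType) (n : nat) (u v : 'cV[Cplx R]_n) :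
  hdot v u = Num.conj (hdot u v).
Proof.
rewrite !hdotE rmorph_sum; apply: eq_bigr => i _.
by rewrite rmorphM /= conjCK mulrC.
Qed.

Lemma hdotDl (R : realType) (n : nat) (u v w : 'cV[Cplx R]_n) :
  hdot (u + v) w = hdot u w + hdot v w.
Proof. by rewrite /hdot mulmxDr mxE. Qed.
Lemma hdotNl (R : realType) (n : nat) (u v : 'cV[Cplx R]_n) :
  hdot (- u) v = - hdot u v.
Proof. by rewrite /hdot mulmxN mxE. Qed.
Lemma hdotZl (R : realType) (n : nat) (c : Cplx R) (u v : 'cV[Cplx R]_n) :
  hdot (c *: u) v = c * hdot u v.
Proof. by rewrite /hdot -scalemxAr mxE. Qed.
Lemma hdotDr (R : realType) (n : nat) (u v w : 'cV[Cplx R]_n) :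
  hdot w (u + v) = hdot w u + hdot w v.
Proof. by rewrite !(hdotC _ w) hdotDl rmorphD. Qed.
Lemma hdotNr (R : realType) (n : nat) (u v : 'cV[Cplx R]_n) :
  hdot u (- v) = - hdot u v.
Proof. by rewrite !(hdotC _ u) hdotNl rmorphN. Qed.
Lemma hdotZr (R : realType) (n : nat) (c : Cplx R) (u v : 'cV[Cplx R]_n) :
  hdot u (c *: v) = Num.conj c * hdot u v.
Proof. by rewrite !(hdotC _ u) hdotZl rmorphM. Qed.
Lemma hdot0l (R : realType) (n : nat) (u : 'cV[Cplx R]_n) : hdot 0 u = 0.
Proof. by rewrite -(scale0r 0) hdotZl mul0r. Qed.
Lemma hdot0r (R : realType) (n : nat) (u : 'cV[Cplx R]_n) : hdot u 0 = 0.
Proof. by rewrite hdotC hdot0l rmorph0. Qed.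
Lemma norm20 (R : realType) (n : nat) : norm2 (0 : 'cV[Cplx R]_n) = 0.
Proof. by rewrite /norm2 hdot0l. Qed.

Lemma im_hdot (R : realType) (n : nat) (u : 'cV[Cplx R]_n) : im (hdot u u) = 0.
Proof.
have := congr1 (@im R) (hdotC u u); rewrite imJ => h; lra.
Qed.

Lemma re_hdotC (R : realType) (n : nat) (u v : 'cV[Cplx R]_n) :
  re (hdot v u) = re (hdot u v).
Proof. by rewrite hdotC reJ. Qed.
Lemma im_hdotC (R : realType) (n : nat) (u v : 'cV[Cplx R]_n) :
  im (hdot v u) = - im (hdot u v).
Proof. by rewrite hdotC imJ. Qed.

Lemma norm2D (R : realType) (n : nat) (u v : 'cV[Cplx R]_n) :
  norm2 (u + v) = norm2 u + 2 * re (hdot u v) + norm2 v.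
Proof. by rewrite /norm2 hdotDl !hdotDr !reD (re_hdotC u v); ring. Qed.
Lemma norm2N (R : realType) (n : nat) (u : 'cV[Cplx R]_n) : norm2 (- u) = norm2 u.
Proof. by rewrite /norm2 hdotNl hdotNr opprK. Qed.
Lemma norm2B (R : realType) (n : nat) (u v : 'cV[Cplx R]_n) :
  norm2 (u - v) = norm2 u - 2 * re (hdot u v) + norm2 v.
Proof. by rewrite norm2D norm2N hdotNr reN; ring. Qed.
Lemma norm2Z (R : realType) (n : nat) (c : Cplx R) (u : 'cV[Cplx R]_n) :
  norm2 (c *: u) = abs2 c * norm2 u.
Proof. by rewrite /norm2 hdotZl hdotZr /abs2 !cE im_hdot; ring. Qed.

Lemma norm2_distC (R : realType) (n : nat) (u v : 'cV[Cplx R]_n) :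
  norm2 (u - v) = norm2 (v - u).
Proof. by rewrite -norm2N opprB. Qed.

Lemma cauchy_schwarz (R : realType) (n : nat) (u v : 'cV[Cplx R]_n) :
  abs2 (hdot u v) <= norm2 u * norm2 v.
Proof.
have [v0|v0] := eqVneq (norm2 v) 0.
  by rewrite (norm2_eq0 v0) hdot0r norm20 mulr0 /abs2 re0 im0 !expr0n /= addr0.
have vp : 0 < norm2 v by rewrite lt0r v0 norm2_ge0.
(* The projection of [u] off [v], scaled by [norm2 v] to avoid a division. *)
have := norm2_ge0 (cof (norm2 v) 0 *: u - hdot u v *: v).
rewrite norm2B !norm2Z hdotZl hdotZr {1}/abs2 !cE.
have -> : (norm2 v ^+ 2 + 0 ^+ 2) * norm2 u -
  2 * (norm2 v * (re (hdot u v) * re (hdot u v) - - im (hdot u v) * im (hdot u v)) -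
  0 * (re (hdot u v) * im (hdot u v) + - im (hdot u v) * re (hdot u v))) +
  abs2 (hdot u v) * norm2 v = norm2 v * (norm2 u * norm2 v - abs2 (hdot u v)).
  by rewrite /abs2; ring.
by rewrite pmulr_rge0 // subr_ge0.
Qed.

(** The missing term is [norm2 (u - v)], by the parallelogram law. This stands in for the triangle
    inequality, since distances are kept squared. *)
Lemma norm2D_le (R : realType) (n : nat) (u v : 'cV[Cplx R]_n) :
  norm2 (u + v) <= 2 * norm2 u + 2 * norm2 v.
Proof. by have := norm2_ge0 (u - v); rewrite norm2B norm2D; lra. Qed.

Lemma norm2_dist_le (R : realType) (n : nat) (u v w : 'cV[Cplx R]_n) :
  norm2 (u - w) <= 2 * norm2 (u - v) + 2 * norm2 (v - w).
Proof. by rewrite -(subrKA v) norm2D_le. Qed.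

Lemma norm2_col (R : realType) (m n : nat) (u : 'cV[Cplx R]_m) (v : 'cV[Cplx R]_n) :
  norm2 (col_mx u v) = norm2 u + norm2 v.
Proof.
rewrite !norm2E big_split_ord; congr (_ + _); apply: eq_bigr => i _.
  by rewrite col_mxEu.
by rewrite col_mxEd.
Qed.

Lemma hdot_mulmx (R : realType) (m n : nat) (M : 'M[Cplx R]_(m, n)) u v :
  hdot (M *m u) v = hdot u (M^t* *m v).
Proof.
rewrite /hdot; suff -> : (M^t* *m v)^t* = v^t* *m M by rewrite mulmxA.
by rewrite trmx_mul map_mxM trmxCK.
Qed.

(** * The row norm through the quadratic form of the Gram matrix *)

Definition rowform (R : realType) (d n : nat) (X : mxtuple R d n)
  (x : 'cV[Cplx R]_n) : R := \sum_j norm2 ((X j)^t* *m x).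

Lemma rowform_ge0 (R : realType) (d n : nat) (X : mxtuple R d n) x :
  0 <= rowform X x.
Proof. by apply: sumr_ge0 => j _; exact: norm2_ge0. Qed.

Lemma norm2_mulmx_bounded (R : realType) (m n : nat) (A : 'M[Cplx R]_(m, n)) :
  exists2 K : R, 0 <= K & forall v, norm2 (A *m v) <= K * norm2 v.
Proof.
(* The squared Frobenius norm of [A]: Cauchy-Schwarz is applied row by row. *)
exists (\sum_i norm2 ((row i A)^t*)); first by apply: sumr_ge0 => i _; exact: norm2_ge0.
move=> v; rewrite norm2E mulr_suml; apply: ler_sum => i _.
rewrite mulrC; have := cauchy_schwarz v ((row i A)^t*).
by rewrite /hdot trmxCK -row_mul mxE.
Qed.

Lemma l2norm_le1 (R : realType) (n : nat) (v : 'cV[Cplx R]_n) :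
  (l2norm v <= 1) = (norm2 v <= 1).
Proof.
by rewrite l2normE -[in RHS](sqr_sqrtr (norm2_ge0 v)) expr_le1 // sqrtr_ge0.
Qed.

Lemma opnorm_has_sup (R : realType) (n : nat) (A : 'M[Cplx R]_n) :
  has_sup [set l2norm (A *m v) | v in [set v : 'cV[Cplx R]_n | l2norm v <= 1]].
Proof.
split.
  by exists (l2norm (A *m 0)); exists 0 => //=; rewrite l2norm_le1 norm20.
have [K K0 hK] := norm2_mulmx_bounded A.
exists (Num.sqrt K) => y [v] /=; rewrite l2norm_le1 => v1 <-.
rewrite l2normE ler_sqrt //; apply: le_trans (hK v) _.
by rewrite ler_piMr.
Qed.

Lemma opnorm_ge0 (R : realType) (n : nat) (A : 'M[Cplx R]_n) : 0 <= opnorm A.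
Proof.
have [_ ub] := opnorm_has_sup A.
apply: (ub_le_sup ub); exists 0 => [|]; first by rewrite /= l2norm_le1 norm20.
by rewrite mulmx0 l2normE norm20 sqrtr0.
Qed.

Lemma norm2_opnorm (R : realType) (n : nat) (A : 'M[Cplx R]_n) v :
  norm2 (A *m v) <= opnorm A ^+ 2 * norm2 v.
Proof.
have [v0|v0] := eqVneq (norm2 v) 0.
  by rewrite (norm2_eq0 v0) mulmx0 norm20 mulr0.
have vp : 0 < norm2 v by rewrite lt0r v0 norm2_ge0.
pose c : Cplx R := cof (Num.sqrt (norm2 v))^-1 0.
have cE : abs2 c = (norm2 v)^-1.
  by rewrite /abs2 re_cof im_cof expr0n /= addr0 exprVn sqr_sqrtr // ltW.
have [_ ub] := opnorm_has_sup A.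
have : l2norm (A *m (c *: v)) <= opnorm A.
  apply: (ub_le_sup ub); exists (c *: v) => //=.
  by rewrite l2norm_le1 norm2Z cE mulVf.
rewrite l2normE => h.
have : norm2 (A *m (c *: v)) <= opnorm A ^+ 2.
  by rewrite -(sqr_sqrtr (norm2_ge0 _)) lerXn2r // nnegrE ?sqrtr_ge0 ?opnorm_ge0.
by rewrite -scalemxAr norm2Z cE mulrC ler_pdivrMr.
Qed.

Lemma opnorm_le (R : realType) (n : nat) (A : 'M[Cplx R]_n) (t : R) :
  0 <= t -> (forall v, norm2 (A *m v) <= t ^+ 2 * norm2 v) -> opnorm A <= t.
Proof.
move=> t0 h; have [ne _] := opnorm_has_sup A.
apply: ge_sup => // y [v] /=; rewrite l2norm_le1 => v1 <-.
rewrite l2normE -(ger0_norm t0) -sqrtr_sqr ler_sqrt ?sqr_ge0 //.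
by apply: le_trans (h v) _; rewrite ler_piMr ?sqr_ge0.
Qed.

Definition gram (R : realType) (d n : nat) (X : mxtuple R d n) : 'M[Cplx R]_n :=
  \sum_j X j *m (X j)^t*.

Lemma hdot_suml (R : realType) (I : finType) (n : nat) (F : I -> 'cV[Cplx R]_n) v :
  hdot (\sum_i F i) v = \sum_i hdot (F i) v.
Proof.
exact: (big_morph (fun u => hdot u v) (fun x y => @hdotDl R n x y v) (@hdot0l R n v)).
Qed.

Lemma hdot_gram (R : realType) (d n : nat) (X : mxtuple R d n) x y :
  hdot (gram X *m x) y = \sum_j hdot ((X j)^t* *m x) ((X j)^t* *m y).
Proof.
rewrite /gram mulmx_suml hdot_suml; apply: eq_bigr => j _.
by rewrite -mulmxA hdot_mulmx.
Qed.

Lemma rowformE (R : realType) (d n : nat) (X : mxtuple R d n) x :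
  rowform X x = re (hdot (gram X *m x) x).
Proof. by rewrite hdot_gram re_sum. Qed.

Lemma rowform_col (R : realType) (d n : nat) (X : mxtuple R d n) (x y : 'cV[Cplx R]_n) (c : R) :
  rowform X (x - cof c 0 *: y) =
  rowform X x - 2 * c * re (hdot (gram X *m x) y) + c ^+ 2 * rowform X y.
Proof.
rewrite hdot_gram re_sum /rowform !mulr_sumr -sumrB -big_split /=.
apply: eq_bigr => j _.
rewrite mulmxBr -scalemxAr norm2B norm2Z hdotZr /abs2 !cE; ring.
Qed.

Lemma rowform_rownorm (R : realType) (d n : nat) (X : mxtuple R d n) x :
  rowform X x <= rownorm X ^+ 2 * norm2 x.
Proof.
rewrite /rownorm sqr_sqrtr ?opnorm_ge0 // -/(gram X) rowformE.
set A := gram X; set h := re _.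
have h2 : h ^+ 2 <= (opnorm A * norm2 x) ^+ 2.
  apply: le_trans (_ : abs2 (hdot (A *m x) x) <= _).
    by rewrite /abs2 lerDl sqr_ge0.
  apply: le_trans (cauchy_schwarz _ _) _.
  rewrite exprMn [norm2 x ^+ 2]expr2 mulrA ler_wpM2r ?norm2_ge0 //.
  exact: norm2_opnorm.
apply: le_trans (ler_norm _) _.
rewrite -(ler_pXn2r (n := 2)) // ?nnegrE ?normr_ge0 ?mulr_ge0 ?opnorm_ge0 ?norm2_ge0 //.
by rewrite real_normK ?num_real.
Qed.

Lemma rownorm_ge0 (R : realType) (d n : nat) (X : mxtuple R d n) : 0 <= rownorm X.
Proof. exact: sqrtr_ge0. Qed.

(* The Gram matrix is positive, so its norm is controlled by its quadratic form:
   expand the form at [x - c y] with [y = gram X *m x] and [c = t^-1]. *)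
Lemma rownorm_le (R : realType) (d n : nat) (X : mxtuple R d n) (t : R) :
  0 <= t -> (forall x, norm2 x = 1 -> rowform X x <= t) -> rownorm X <= Num.sqrt t.
Proof.
move=> t0 h1; rewrite ler_sqrt //; apply: opnorm_le => // x.
have h y : rowform X y <= t * norm2 y.
  have [y0|y0] := eqVneq (norm2 y) 0.
    rewrite (norm2_eq0 y0) norm20 mulr0 rowformE mulmx0 hdot0l //.
  have yp : 0 < norm2 y by rewrite lt0r y0 norm2_ge0.
  pose c := (Num.sqrt (norm2 y))^-1.
  have c2 : c ^+ 2 = (norm2 y)^-1 by rewrite exprVn sqr_sqrtr // ltW.
  (* Expanding at [0 - c y] gives the homogeneity of the form, hence reduces to unit vectors. *)
  have := h1 (0 - cof c 0 *: y).
  rewrite rowform_col sub0r norm2N norm2Z /abs2 re_cof im_cof expr0n /= addr0 c2.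
  rewrite mulVf // mulmx0 hdot0l re0 mulr0 subr0 => /(_ erefl).
  rewrite rowformE mulmx0 hdot0l re0 add0r mulrC ler_pdivrMr //.
rewrite -/(gram X); set y := gram X *m x.
have yx : re (hdot (gram X *m x) y) = norm2 y by [].
have [tz|tn] := eqVneq t 0.
  have e0 : forall z, rowform X z = 0.
    move=> z; apply/eqP; rewrite eq_le rowform_ge0 andbT.
    by apply: le_trans (h z) _; rewrite tz mul0r.
  have := e0 (x - cof 1 0 *: y); rewrite rowform_col !e0 yx tz; lra.
have tp : 0 < t by rewrite lt0r tn.
have := rowform_ge0 X (x - cof t^-1 0 *: y); rewrite rowform_col yx => h0.
have := h x; have := h y => hy hx.
have : 0 <= t * norm2 x - 2 * t^-1 * norm2 y + t ^-1 ^+2 * (t * norm2 y).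
  apply: le_trans h0 _; rewrite lerD // ?lerB // ?ler_wpM2l // ?sqr_ge0 //.
have -> : t * norm2 x - 2 * t^-1 * norm2 y + t^-1 ^+ 2 * (t * norm2 y) =
  t^-1 * (t ^+ 2 * norm2 x - norm2 y) by field.
by rewrite pmulr_rge0 ?invr_gt0 // subr_ge0.
Qed.

Lemma rownorm_lt1 (R : realType) (d n : nat) (X : mxtuple R d n) (t : R) :
  t < 1 -> (forall x, rowform X x <= t * norm2 x) -> rownorm X < 1.
Proof.
(* A negative [t] is allowed here, whereas [rownorm_le] wants a nonnegative bound. *)
move=> t1 h; have m0 : 0 <= Num.max t 0 by rewrite le_max lexx orbT.
have := @rownorm_le R d n X _ m0; move=> hh.
apply: le_lt_trans (hh _) _.
  by move=> x x1; apply: le_trans (h x) _; rewrite x1 mulr1 le_max lexx.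
by rewrite -[ltRHS]sqrtr1 ltr_sqrt // gt_max t1 ltr01.
Qed.

Lemma rowball_form (R : realType) (d n : nat) (X : mxtuple R d n) :
  rowball X -> exists2 t : R, 0 <= t < 1 & forall x, rowform X x <= t * norm2 x.
Proof.
case=> n0 X1; exists (rownorm X ^+ 2); last exact: rowform_rownorm.
by rewrite sqr_ge0 expr_lt1 ?rownorm_ge0.
Qed.

Lemma rowball_form_le (R : realType) (d n : nat) (X : mxtuple R d n) x :
  rowball X -> rowform X x <= norm2 x.
Proof.
case/rowball_form => t /andP[_ t1] /(_ x) h; apply: le_trans h _.
by rewrite ler_piMl ?norm2_ge0 // ltW.
Qed.

Lemma const_tuple_form (R : realType) (d n : nat) (z : 'cV[Cplx R]_d) (x : 'cV[Cplx R]_n) :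
  rowform (const_tuple z n) x = norm2 z * norm2 x.
Proof.
rewrite /rowform [norm2 z]norm2E mulr_suml; apply: eq_bigr => j _.
rewrite ffunE tr_scalar_mx map_scalar_mx mul_scalar_mx norm2Z /= /abs2.
by rewrite !cE sqrrN.
Qed.

(** The cross term pairs [z] with the vector of the numbers [hdot (X j *m x) x], which is the
    quantity that [nc_schwarz_pick0] controls. *)
Lemma rowform_dist_const (R : realType) (d n : nat) (X : mxtuple R d n)
    (z : 'cV[Cplx R]_d) (x : 'cV[Cplx R]_n) :
  rowform (X - const_tuple z n) x =
  rowform X x - 2 * re (hdot (\col_j hdot (X j *m x) x) z) + norm2 z * norm2 x.
Proof.
rewrite -const_tuple_form hdotE re_sum mulr_sumr /rowform -sumrB -big_split /=.
apply: eq_bigr => j _; rewrite !ffunE mxE.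
rewrite linearB /= map_mxB /= mulmxBl norm2B; congr (_ - 2 * _ + _).
rewrite tr_scalar_mx map_scalar_mx mul_scalar_mx hdotZr /=.
by rewrite conjCK (hdotC x ((X j)^t* *m x)) -hdot_mulmx !cE; ring.
Qed.

Lemma const_tuple_level1 (R : realType) (d : nat) (f : graded_map R d) z :
  f 1%N (const_tuple z 1) = const_tuple (level1 f z) 1.
Proof. by apply/ffunP => j; rewrite ffunE mxE; exact: mx11_scalar. Qed.

Lemma rownorm_const_le (R : realType) (d n : nat) (z : 'cV[Cplx R]_d) :
  rownorm (const_tuple z n) <= l2norm z.
Proof.
rewrite l2normE; apply: rownorm_le; first exact: norm2_ge0.
by move=> x x1; rewrite const_tuple_form x1 mulr1.
Qed.

Lemma const_tuple_rowball (R : realType) (d : nat) (z : 'cV[Cplx R]_d) :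
  rowball (const_tuple z 1) <-> norm2 z < 1.
Proof.
split=> [/rowball_form[t /andP[_ t1] /(_ 1%:M)]|z1].
  rewrite const_tuple_form; suff -> : norm2 (1%:M : 'cV[Cplx R]_1) = 1.
    by rewrite !mulr1 => h; apply: le_lt_trans h t1.
  by rewrite norm2E big_ord1 mxE eqxx mulr1n /abs2 !cE; ring.
split=> //; apply: le_lt_trans (rownorm_const_le _ _) _.
by rewrite l2normE -[ltRHS]sqrtr1 ltr_sqrt.
Qed.

(** * Block triangular points of the row ball *)

Definition shear (R : realType) (d n : nat) (v : 'cV[Cplx R]_n)
    (X : mxtuple R d n) (W : mxtuple R d 1) : mxtuple R d (n + 1) :=
  [ffun j => block_mx (X j) (X j *m v - v *m W j) 0 (W j)].

Definition unipotent (R : realType) (n : nat) (v : 'cV[Cplx R]_n) :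
  'M[Cplx R]_(n + 1) := block_mx 1%:M v 0 1%:M.

Lemma unipotentN (R : realType) (n : nat) (v : 'cV[Cplx R]_n) :
  unipotent (- v) *m unipotent v = 1%:M.
Proof.
rewrite mulmx_block !mulmx0 !mul0mx !mulmx1 !mul1mx !addr0 add0r subrr.
by rewrite -scalar_mx_block.
Qed.

Lemma shear_similar (R : realType) (d n : nat) (v : 'cV[Cplx R]_n)
    (X : mxtuple R d n) (W : mxtuple R d 1) :
  similar_tuple (unipotent v) (dsum X W) = shear v X W.
Proof.
have [_ uv] := mulmx1_unit (unipotentN v).
have -> : similar_tuple (unipotent v) (dsum X W) =
    [ffun j => unipotent (- v) *m dsum X W j *m unipotent v].
  apply/ffunP => j; rewrite !ffunE; congr (_ *m _ *m _).
  by rewrite -[RHS]mulmx1 -(mulmxV uv) mulmxA unipotentN mul1mx.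
apply/ffunP => j; rewrite !ffunE !mulmx_block.
rewrite !mulmx0 !mul0mx !mulmx1 !mul1mx !addr0 !add0r mulNmx.
by rewrite mul0mx add0r.
Qed.

Lemma rowform_dsum (R : realType) (d n m : nat) (X : mxtuple R d n) (W : mxtuple R d m) x y :
  rowform (dsum X W) (col_mx x y) = rowform X x + rowform W y.
Proof.
rewrite /rowform -big_split; apply: eq_bigr => j _ /=.
rewrite ffunE tr_block_mx map_block_mx mul_block_col !trmx0 !map_mx0 !mul0mx.
by rewrite addr0 add0r norm2_col.
Qed.

Lemma dsum_rowball (R : realType) (d n m : nat) (X : mxtuple R d n) (W : mxtuple R d m) :
  rowball X -> rowball W -> rowball (dsum X W).
Proof.
move=> bX bW; split; first by case: bX => n0 _; rewrite addn_gt0 n0.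
have [s /andP[s0 s1] hs] := rowball_form bX.
have [t /andP[t0 t1] ht] := rowball_form bW.
apply: (@rownorm_lt1 _ _ _ _ (Num.max s t)); first by rewrite gt_max s1.
move=> x; rewrite -[x]vsubmxK rowform_dsum norm2_col mulrDr.
apply: lerD; [apply: le_trans (hs _) _|apply: le_trans (ht _) _].
  by rewrite ler_wpM2r ?norm2_ge0 // le_max lexx.
by rewrite ler_wpM2r ?norm2_ge0 // le_max lexx orbT.
Qed.

Lemma nc_shear (R : realType) (d n : nat) (f : graded_map R d) (v : 'cV[Cplx R]_n)
    (X : mxtuple R d n) (W : mxtuple R d 1) :
  nc_selfmap f -> rowball X -> rowball W -> rowball (shear v X W) ->
  rowball (shear v (f n X) (f 1%N W)).
Proof.
move=> [fb fs fc] bX bW bP.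
have [_ uv] := mulmx1_unit (unipotentN v).
have bD : rowball (dsum X W) by exact: dsum_rowball.
have bS : rowball (similar_tuple (unipotent v) (dsum X W)) by rewrite shear_similar.
have fD := fs _ _ X W bX bW.
have := fc _ (unipotent v) (dsum X W) uv bD bS.
rewrite fD !shear_similar => <-.
exact: fb.
Qed.

(** The lower block row of each adjoint applied to the column is a scalar; the conjugates of these
    [d] scalars form a vector of C^d, in which the two terms with [w] are collected. *)
Lemma rowform_shear_const (R : realType) (d n : nat) (v : 'cV[Cplx R]_n)
    (X : mxtuple R d n) (w : 'cV[Cplx R]_d) x (y : Cplx R) :
  rowform (shear v X (const_tuple w 1)) (col_mx x y%:M) =
  rowform X x +
  norm2 (\col_j hdot (X j *m v) x + (Num.conj y - hdot v x) *: w).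
Proof.
rewrite [norm2 _]norm2E -big_split; apply: eq_bigr => j _ /=.
rewrite ffunE tr_block_mx map_block_mx mul_block_col !trmx0 !map_mx0 !mul0mx addr0.
rewrite norm2_col; congr (_ + _).
rewrite norm2E big_ord1 ffunE.
set a := (_ + _ : 'cV__) 0 0; set b := (_ + _ : 'cV__) _ _.
suff -> : a = Num.conj b by rewrite /abs2 !cE sqrrN.
have -> : a = hdot x (X j *m v - w j 0 *: v) + Num.conj (w j 0) * y.
  rewrite /a mxE mul_mx_scalar; congr (_ + _).
  by rewrite tr_scalar_mx map_scalar_mx -scalar_mxM mxE eqxx mulr1n.
rewrite /b !mxE hdotDr hdotNr hdotZr (hdotC _ x) (hdotC v x) rmorphD rmorphM rmorphB /= conjCK.
ring.
Qed.

(** * Iterates and their restriction to level 1 *)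

Lemma nc_selfmap_iter (R : realType) (d : nat) (f : graded_map R d) k :
  nc_selfmap f -> nc_selfmap (fun n => iter k (f n)).
Proof.
move=> hf; elim: k => [|k [gb gs gc]]; first by split.
have [fb fs fc] := hf.
split=> [n X bX|m n X Y bX bY|n S X uS bX bS] /=; first exact/fb/gb.
  have e := gs m n X Y bX bY; have e' := fs m n _ _ (gb _ _ bX) (gb _ _ bY).
  exact: etrans (congr1 (f _) e) e'.
(* The similarity clause of [f] needs the conjugate of the iterate of [X] to be in the ball; it is
   the iterate at the conjugate of [X]. *)
have e := gc n S X uS bX bS; have bgS := gb _ _ bS; rewrite /= e in bgS.
exact: etrans (congr1 (f _) e) (fc n S _ uS (gb _ _ bX) bgS).
Qed.

Lemma level1_iter (R : realType) (d : nat) (f : graded_map R d) k z :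
  const_tuple (iter k (level1 f) z) 1 = iter k (f 1%N) (const_tuple z 1).
Proof. by elim: k => //= k <-; rewrite const_tuple_level1. Qed.

Lemma const_tuple_inj (R : realType) (d : nat) (z w : 'cV[Cplx R]_d) :
  const_tuple z 1 = const_tuple w 1 -> z = w.
Proof.
move=> h; apply/matrixP => j k; rewrite ord1.
by have := congr1 (fun X : mxtuple R d 1 => X j 0 0) h; rewrite !ffunE !mxE eqxx.
Qed.

(** * The Schwarz-Pick inequality at level 1 *)

Definition kerD (R : realType) (d : nat) (z w : 'cV[Cplx R]_d) : R :=
  (1 - norm2 z) * (1 - norm2 w).
Definition kerN (R : realType) (d : nat) (z w : 'cV[Cplx R]_d) : R :=
  abs2 (1 - hdot z w).

Lemma kerNE (R : realType) (d : nat) (z w : 'cV[Cplx R]_d) :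
  kerN z w = (1 - re (hdot z w)) ^+ 2 + im (hdot z w) ^+ 2.
Proof. by rewrite /kerN /abs2 !cE; ring. Qed.

Lemma kerNC (R : realType) (d : nat) (z w : 'cV[Cplx R]_d) : kerN z w = kerN w z.
Proof. by rewrite !kerNE re_hdotC im_hdotC sqrrN. Qed.

Lemma kerDC (R : realType) (d : nat) (z w : 'cV[Cplx R]_d) : kerD z w = kerD w z.
Proof. by rewrite /kerD mulrC. Qed.

(** The right-hand side is visibly nonnegative when [w] is in the ball, and it is the expression
    that the determinant of the shear form produces. *)
Lemma kerN_sub_kerD (R : realType) (d : nat) (z w : 'cV[Cplx R]_d) :
  kerN z w - kerD z w =
  norm2 (z - w) * (1 - norm2 w) + abs2 (hdot (z - w) w).
Proof.
rewrite kerNE /kerD norm2B hdotDl hdotNl /abs2 !cE im_hdot -/(norm2 w).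
ring.
Qed.

Lemma kerD_gt0 (R : realType) (d : nat) (z w : 'cV[Cplx R]_d) :
  norm2 z < 1 -> norm2 w < 1 -> 0 < kerD z w.
Proof. by move=> z1 w1; rewrite mulr_gt0 ?subr_gt0. Qed.

Lemma kerD_le_kerN (R : realType) (d : nat) (z w : 'cV[Cplx R]_d) :
  norm2 w < 1 -> kerD z w <= kerN z w.
Proof.
move=> w1; rewrite -subr_ge0 kerN_sub_kerD addr_ge0 ?abs2_ge0 //.
by rewrite mulr_ge0 ?norm2_ge0 // subr_ge0 ltW.
Qed.

(** The least eigenvalue of a positive 2 x 2 Hermitian matrix is at least its determinant over its
    trace, [la]. Subtracting [la] from the diagonal leaves the determinant [la ^+ 2] and a positive
    corner, so completing the square works. The vector is [(a + ib, e + ig)] and the off-diagonal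
    entry has real and imaginary parts [k1], [k2] up to sign. *)
Lemma posdef2 (R : realType) (al ga k1 k2 a b e g : R) :
  0 < al -> 0 < ga -> 0 < al * ga - (k1 ^+ 2 + k2 ^+ 2) ->
  (al * ga - (k1 ^+ 2 + k2 ^+ 2)) / (al + ga) * (a ^+ 2 + b ^+ 2 + (e ^+ 2 + g ^+ 2)) <=
  al * (a ^+ 2 + b ^+ 2) - 2 * (a * (e * k1 + g * k2) + b * (g * k1 - e * k2))
  + ga * (e ^+ 2 + g ^+ 2).
Proof.
move=> al0 ga0 de0; set de := al * ga - _ in de0 *.
have s0 : 0 < al + ga by rewrite addr_gt0.
set la := de / (al + ga).
have laE : la * (al + ga) = de by rewrite /la divfK // gt_eqF.
have A0 : 0 < al - la.
  rewrite subr_gt0 /la ltr_pdivrMr // /de.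
  by have := sqr_ge0 k1; have := sqr_ge0 k2; have := mulr_gt0 al0 al0; nra.
have AB : (al - la) * (ga - la) = k1 ^+ 2 + k2 ^+ 2 + la ^+ 2.
  have -> : (al - la) * (ga - la) = al * ga - la * (al + ga) + la ^+ 2 by ring.
  by rewrite laE /de; ring.
set A := al - la in A0 AB; set B := ga - la in AB.
set p := e * k1 + g * k2; set q := g * k1 - e * k2.
rewrite -subr_ge0 -(pmulr_rge0 _ A0).
rewrite (_ : A * _ = (A * a - p) ^+ 2 + (A * b - q) ^+ 2 +
                     (A * B - (k1 ^+ 2 + k2 ^+ 2)) * (e ^+ 2 + g ^+ 2)).
  have -> : A * B - (k1 ^+ 2 + k2 ^+ 2) = la ^+ 2 by rewrite AB; ring.
  rewrite addr_ge0 //; first by rewrite addr_ge0 ?sqr_ge0.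
  by rewrite mulr_ge0 ?sqr_ge0 // addr_ge0 ?sqr_ge0.
by rewrite /p /q /A /B; ring.
Qed.

Lemma norm2_1 (R : realType) (y : Cplx R) : norm2 (y%:M : 'cV[Cplx R]_1) = abs2 y.
Proof. by rewrite norm2E big_ord1 mxE eqxx mulr1n. Qed.

(** The defect from the squared norm is arranged in the shape of [posdef2], with [k1 = c * re h] and
    [k2 = - (c * im h)]. *)
Lemma shear1_form (R : realType) (d : nat) (c : R) (z w : 'cV[Cplx R]_d) (xi y : Cplx R) :
  let h := hdot (z - w) w in
  rowform (shear (cof c 0)%:M (const_tuple z 1) (const_tuple w 1)) (col_mx xi%:M y%:M) =
  (abs2 xi + abs2 y) -
  ((1 - norm2 z - c ^+ 2 * norm2 (z - w)) * abs2 xi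
   - 2 * (re xi * (re y * (c * re h) + im y * - (c * im h))
        + im xi * (im y * (c * re h) - re y * - (c * im h)))
   + (1 - norm2 w) * abs2 y).
Proof.
move=> h; rewrite rowform_shear_const const_tuple_form norm2_1.
have e : hdot (cof c 0)%:M xi%:M = cof c 0 * Num.conj xi.
  by rewrite hdotE big_ord1 !mxE eqxx !mulr1n.
rewrite (_ : \col_j _ + _ = (cof c 0 * Num.conj xi) *: (z - w) + Num.conj y *: w); last first.
  apply/matrixP => j k; rewrite ord1 !mxE ffunE mul_scalar_mx hdotZl e; ring.
rewrite (norm2D (_ *: _)) !norm2Z hdotZl hdotZr -/h /abs2 !cE; ring.
Qed.

(** By [kerN_sub_kerD], the hypothesis on [c] says that the defect form has positive determinant;
    its lower diagonal entry [1 - norm2 w] is positive, so it is positive definite. *)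
Lemma shear1_rowball (R : realType) (d : nat) (c : R) (z w : 'cV[Cplx R]_d) :
  norm2 z < 1 -> norm2 w < 1 ->
  c ^+ 2 * (kerN z w - kerD z w) < kerD z w ->
  rowball (shear (cof c 0)%:M (const_tuple z 1) (const_tuple w 1)).
Proof.
move=> z1 w1; rewrite kerN_sub_kerD /kerD => hc; split=> //.
set h := hdot (z - w) w in hc; set P := norm2 (z - w) in hc.
pose al := 1 - norm2 z - c ^+ 2 * P; pose ga := 1 - norm2 w.
have ga0 : 0 < ga by rewrite subr_gt0.
have de0 : 0 < al * ga - ((c * re h) ^+ 2 + (- (c * im h)) ^+ 2).
  rewrite (_ : al * ga - _ = (1 - norm2 z) * (1 - norm2 w) -
    c ^+ 2 * (P * (1 - norm2 w) + abs2 h)) ?subr_gt0 //.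
  by rewrite /abs2 /al /ga; ring.
have al0 : 0 < al.
  rewrite -(pmulr_lgt0 _ ga0); apply: lt_le_trans de0 _.
  by rewrite gerBl addr_ge0 ?sqr_ge0.
pose t := (al * ga - ((c * re h) ^+ 2 + (- (c * im h)) ^+ 2)) / (al + ga).
have t0 : 0 < t by rewrite divr_gt0 // addr_gt0.
apply: (@rownorm_lt1 _ _ _ _ (1 - t)); first by rewrite gtrBl.
move=> x; rewrite -[x]vsubmxK [dsubmx x]mx11_scalar [usubmx x]mx11_scalar.
rewrite norm2_col !norm2_1 shear1_form -/h -/P [leRHS]mulrBl mul1r lerB //.
exact: posdef2.
Qed.

Lemma shear1_rowball_inv (R : realType) (d : nat) (c : R) (z w : 'cV[Cplx R]_d) :
  norm2 z < 1 -> norm2 w < 1 ->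
  rowball (shear (cof c 0)%:M (const_tuple z 1) (const_tuple w 1)) ->
  c ^+ 2 * (kerN z w - kerD z w) <= kerD z w.
Proof.
move=> z1 w1 bP; rewrite kerN_sub_kerD /kerD.
set h := hdot (z - w) w; set P := norm2 (z - w).
have ga0 : 0 < 1 - norm2 w by rewrite subr_gt0.
(* For the first entry [1 - norm2 w], this second entry minimizes the defect form, whose value is
   then [1 - norm2 w] times its determinant. *)
have := rowball_form_le (col_mx (cof (1 - norm2 w) 0)%:M (cof (c * re h) (- (c * im h)))%:M) bP.
rewrite norm2_col !norm2_1 shear1_form -/h -/P gerBl.
rewrite (_ : _ + _ = (1 - norm2 w) *
  ((1 - norm2 z) * (1 - norm2 w) -
   c ^+ 2 * (P * (1 - norm2 w) + abs2 h))).
  by rewrite pmulr_rge0 // subr_ge0.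
by rewrite /abs2 !re_cof !im_cof; ring.
Qed.

Lemma schwarz_pick (R : realType) (d : nat) (f : graded_map R d)
    (z w : 'cV[Cplx R]_d) :
  nc_selfmap f -> norm2 z < 1 -> norm2 w < 1 ->
  kerN (level1 f z) (level1 f w) * kerD z w <=
  kerN z w * kerD (level1 f z) (level1 f w).
Proof.
move=> hf z1 w1; have [fb _ _] := hf.
set Z := level1 f z; set W := level1 f w.
have bz : rowball (const_tuple z 1) by apply/const_tuple_rowball.
have bw : rowball (const_tuple w 1) by apply/const_tuple_rowball.
have Z1 : norm2 Z < 1 by apply/const_tuple_rowball; rewrite -const_tuple_level1; exact: fb.
have W1 : norm2 W < 1 by apply/const_tuple_rowball; rewrite -const_tuple_level1; exact: fb.
have D0 := kerD_gt0 z1 w1; have D'0 := kerD_gt0 Z1 W1.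
have ND : 0 <= kerN z w - kerD z w by rewrite subr_ge0 kerD_le_kerN.
rewrite leNgt; apply/negP => lt.
set a := kerN z w - kerD z w in ND *; set a' := kerN Z W - kerD Z W.
have lt' : a * kerD Z W < a' * kerD z w.
  by rewrite -subr_gt0; move: lt; rewrite -subr_gt0 /a /a'; congr (_ < _); ring.
have a'0 : 0 < a'.
  by rewrite -(pmulr_lgt0 _ D0); apply: le_lt_trans lt'; rewrite mulr_ge0 // ltW.
have s0 : 0 < a + a' by rewrite ltr_wpDl.
(* The mediant of [kerD z w / a] and [kerD Z W / a'] lies strictly between them and makes sense even
   for [a = 0]. The shear with this [c] is then in the ball at [z], [w] but not at [Z], [W]. *)
pose c := Num.sqrt ((kerD z w + kerD Z W) / (a + a')).
have c2 : c ^+ 2 = (kerD z w + kerD Z W) / (a + a').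
  by rewrite sqr_sqrtr // divr_ge0 ?ltW // addr_gt0.
have bP : rowball (shear (cof c 0)%:M (const_tuple z 1) (const_tuple w 1)).
  apply: shear1_rowball => //; rewrite c2 -/a mulrAC ltr_pdivrMr //.
  by rewrite -subr_gt0; move: lt'; rewrite -subr_gt0; congr (_ < _); ring.
have := shear1_rowball_inv Z1 W1; rewrite -!const_tuple_level1.
move=> /(_ _ (nc_shear hf bz bw bP)).
rewrite c2 -/a' mulrAC ler_pdivrMr // leNgt => /negP; apply.
by rewrite -subr_gt0; move: lt'; rewrite -subr_gt0; congr (_ < _); ring.
Qed.

(** * Compactness and hyperbolic estimates in the ball *)

Lemma norm2_cluster (R : realType) (d : nat) (u : nat -> 'cV[Cplx R]_d) (B : R) :
  (forall n, norm2 (u n) <= B) ->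
  exists zeta, forall (e : R) (N : nat), 0 < e ->
    exists2 n, (N <= n)%N & norm2 (u n - zeta) < e.
Proof.
move=> uB.
(* Real and imaginary parts side by side, so that compactness of a closed real box applies. *)
pose v n : 'rV[R]_(d + d) := row_mx (\row_j re (u n j 0)) (\row_j im (u n j 0)).
have coordB n j : abs2 (u n j 0) <= B + 1.
  apply: le_trans (_ : norm2 (u n) <= _); last by rewrite (le_trans (uB n)) ?lerDl.
  by rewrite norm2E (bigD1 j) //= lerDl sumr_ge0 // => i _; exact: abs2_ge0.
have vK n : [set x : 'rV[R]_(d + d) | forall i, `[- (B + 1), B + 1] (x 0 i)] (v n).
  have B0 : 0 <= B by apply: le_trans (uB 0); exact: norm2_ge0.
  (* Since [B + 1] is at least 1, it is at most its square, and so bounds the entries as well as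
     their squares. *)
  have sq x : x ^+ 2 <= B + 1 -> `[- (B + 1), B + 1] x.
    move=> h; rewrite /= in_itv /= -ler_norml.
    rewrite -(ler_pXn2r (n := 2)) // ?nnegrE ?addr_ge0 // real_normK ?num_real //.
    by apply: le_trans h _; rewrite ler_eXnr // lerDr.
  move=> i; rewrite -(splitK i); case: (fintype.split i) => j;
    rewrite /v /= ?row_mxEl ?row_mxEr mxE; apply: sq.
    by apply: le_trans (coordB n j); rewrite lerDl sqr_ge0.
  by apply: le_trans (coordB n j); rewrite lerDr sqr_ge0.
have cK : compact _ := @rV_compact R (d + d) (fun=> `[- (B + 1), B + 1]%classic)
  (fun=> @segment_compact R _ _).
have [|p [_ pc]] := cK (v @ \oo) (fmap_proper_filter v _); first by exists 0 => // n _; exact: vK.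
pose zeta : 'cV[Cplx R]_d :=
  \col_j cof (p 0 (lshift d j)) (p 0 (rshift d j)).
exists zeta => e N e0.
(* Each of the [d] entries contributes at most [2 * h ^+ 2]; the extra 1 makes the total strictly
   less than [e] and covers [d = 0]. *)
pose h := Num.sqrt (e / (2 * d%:R + 1)).
have den0 : 0 < 2 * d%:R + 1 :> R by rewrite ltr_wpDl // mulr_ge0.
have h2 : h ^+ 2 = e / (2 * d%:R + 1) by rewrite sqr_sqrtr // divr_ge0 // ltW.
have h0 : 0 < h by rewrite sqrtr_gt0 divr_gt0.
have [|_ [[n Nn <-]] pn] := pc [set v n | n in [set n | (N <= n)%N]] (ball p h) _
    (nbhsx_ballx p h h0).
  by exists N => // n /= Nn; exists n.
exists n => //; apply: le_lt_trans (_ : d%:R * (2 * h ^+ 2) < e); last first.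
  rewrite h2 !mulrA (mulrC d%:R).
  by rewrite ltr_pdivrMr // mulrDr mulr1 (mulrC e) ltrDl.
rewrite norm2E; have -> : d%:R * (2 * h ^+ 2) = \sum_(j < d) (2 * h ^+ 2).
  by rewrite sumr_const card_ord mulr_natl.
apply: ler_sum => j _.
have sqh (x y : R) : ball x h y -> (y - x) ^+ 2 <= h ^+ 2.
  rewrite -ball_normE /= distrC => /ltW xy; rewrite -real_normK ?num_real //.
  by rewrite lerXn2r // nnegrE // ltW.
case: pn => _ pn; have := sqh _ _ (pn 0 (lshift d j)); have := sqh _ _ (pn 0 (rshift d j)).
rewrite /v row_mxEl row_mxEr !mxE /abs2 !cE => ha hb; lra.
Qed.

Definition kerq (R : realType) (d : nat) (z w : 'cV[Cplx R]_d) : R :=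
  kerN z w / kerD z w.

Lemma kerqC (R : realType) (d : nat) (z w : 'cV[Cplx R]_d) : kerq z w = kerq w z.
Proof. by rewrite /kerq kerNC kerDC. Qed.

Lemma kerq_ge1 (R : realType) (d : nat) (z w : 'cV[Cplx R]_d) :
  norm2 z < 1 -> norm2 w < 1 -> 1 <= kerq z w.
Proof.
by move=> z1 w1; rewrite /kerq ler_pdivlMr ?kerD_gt0 // mul1r kerD_le_kerN.
Qed.

Lemma kerq_0r (R : realType) (d : nat) (z : 'cV[Cplx R]_d) :
  kerq z 0 = (1 - norm2 z)^-1.
Proof.
by rewrite /kerq kerNE /kerD hdot0r norm20 !cE !subr0 expr0n /= addr0 expr1n mulr1 mul1r.
Qed.

(** As [kerq] is a squared hyperbolic cosine, this is the square of cosh (s + t) <= 2 cosh s cosh t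
    combined with the triangle inequality. *)
Lemma kerq_triangle (R : realType) (d : nat) (x y : 'cV[Cplx R]_d) :
  norm2 x < 1 -> norm2 y < 1 -> kerq x 0 <= 4 * kerq x y * kerq y 0.
Proof.
move=> x1 y1; rewrite !kerq_0r /kerq /kerD.
have X0 : 0 < 1 - norm2 x by rewrite subr_gt0.
have Y0 : 0 < 1 - norm2 y by rewrite subr_gt0.
have -> : 4 * (kerN x y / ((1 - norm2 x) * (1 - norm2 y))) * (1 - norm2 y)^-1 =
  (1 - norm2 x)^-1 * (4 * kerN x y / (1 - norm2 y) ^+ 2).
  by field; rewrite !gt_eqF.
rewrite ler_pMr ?invr_gt0 // ler_pdivlMr ?exprn_gt0 // mul1r kerNE.
set p := re _; have ps : p ^+ 2 <= norm2 y.
  apply: le_trans (_ : abs2 (hdot x y) <= _); first by rewrite lerDl sqr_ge0.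
  apply: le_trans (cauchy_schwarz _ _) _.
  by rewrite ler_piMl ?norm2_ge0 // ltW.
(* From [1 - norm2 y <= 1 - p ^+ 2 <= 2 * (1 - p)]. *)
have h : 1 - norm2 y <= 2 * (1 - p) by have := sqr_ge0 (1 - p); nra.
have : (1 - norm2 y) ^+ 2 <= (2 * (1 - p)) ^+ 2.
  by rewrite lerXn2r ?nnegrE ?(ltW Y0) // (le_trans (ltW Y0) h).
by have := sqr_ge0 (im (hdot x y)); nra.
Qed.

(** In [kerN_sub_kerD], Cauchy-Schwarz bounds the last term by [norm2 (z - w) * norm2 w], so the two
    terms add up to at most [norm2 (z - w)]. *)
Lemma kerq_near (R : realType) (d : nat) (z w : 'cV[Cplx R]_d) :
  norm2 z < 1 -> norm2 w < 1 -> kerq z w <= 1 + norm2 (z - w) / kerD z w.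
Proof.
move=> z1 w1; have D0 := kerD_gt0 z1 w1.
rewrite /kerq ler_pdivrMr // mulrDl mul1r divfK ?gt_eqF // -lerBlDl kerN_sub_kerD.
by have := cauchy_schwarz (z - w) w; nra.
Qed.

(** * Self-maps of the ball that do not increase [kerq] *)

Definition contracts_ball (R : realType) (d : nat)
    (g : 'cV[Cplx R]_d -> 'cV[Cplx R]_d) : Prop :=
  (forall z, norm2 z < 1 -> norm2 (g z) < 1) /\
  (forall z w, norm2 z < 1 -> norm2 w < 1 -> kerq (g z) (g w) <= kerq z w).

Lemma contracts_ball_iter (R : realType) (d : nat)
    (g : 'cV[Cplx R]_d -> 'cV[Cplx R]_d) k :
  contracts_ball g -> contracts_ball (iter k g).
Proof.
case=> gb gq; elim: k => [|k [ib iq]]; first by split.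
split=> [z z1|z w z1 w1] /=; first exact/gb/ib.
by apply: le_trans (gq _ _ (ib _ z1) (ib _ w1)) _; exact: iq.
Qed.

(** Quantitative continuity: [kerq_near] bounds [kerq z w] from above, and [kerN_sub_kerD] bounds
    [kerq (g z) (g w)] from below. *)
Lemma contracts_ball_dist (R : realType) (d : nat)
    (g : 'cV[Cplx R]_d -> 'cV[Cplx R]_d) z w :
  contracts_ball g -> norm2 z < 1 -> norm2 w < 1 ->
  norm2 (g z - g w) * ((1 - norm2 (g w)) * kerD z w) <= norm2 (z - w).
Proof.
move=> [gb gq] z1 w1; have D0 := kerD_gt0 z1 w1.
have D'0 := kerD_gt0 (gb _ z1) (gb _ w1).
rewrite mulrA -ler_pdivlMr //.
have := le_trans (gq _ _ z1 w1) (kerq_near z1 w1).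
rewrite {1}/kerq ler_pdivrMr // mulrDl mul1r -lerBlDl kerN_sub_kerD => h.
have D'1 : kerD (g z) (g w) <= 1.
  by rewrite /kerD mulr_ile1 ?subr_ge0 ?(ltW (gb _ _)) // gerBl norm2_ge0.
have q0 : 0 <= norm2 (z - w) / kerD z w by rewrite divr_ge0 ?norm2_ge0 // ltW.
have := abs2_ge0 (hdot (g z - g w) (g w)); nra.
Qed.

Lemma sqr_mean_le (R : realType) (c A B s p q p' q' : R) :
  (1 - p) ^+ 2 + q ^+ 2 <= c * ((1 - A) * s) ->
  (1 - p') ^+ 2 + q' ^+ 2 <= c * ((1 - B) * s) ->
  (1 - (p + p') / 2) ^+ 2 + ((q + q') / 2) ^+ 2 <= c * ((1 - (A + B) / 2) * s).
Proof.
move=> hu hv.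
have -> : (1 - (p + p') / 2) ^+ 2 + ((q + q') / 2) ^+ 2 =
    (((1 - p) ^+ 2 + q ^+ 2) + ((1 - p') ^+ 2 + q' ^+ 2)) / 2 -
    ((p - p') ^+ 2 + (q - q') ^+ 2) / 4 by field.
have -> : c * ((1 - (A + B) / 2) * s) = (c * ((1 - A) * s) + c * ((1 - B) * s)) / 2.
  by field.
rewrite lerBlDr; apply: le_trans (_ : (c * ((1 - A) * s) + c * ((1 - B) * s)) / 2 <= _).
  by rewrite ler_pM2r ?invr_gt0 //; exact: lerD hu hv.
by rewrite lerDl divr_ge0 // addr_ge0 ?sqr_ge0.
Qed.

(* The square of the modulus is convex and [1 - norm2] is uniformly concave. *)
Lemma kerq_midpoint (R : realType) (d : nat) (u v a : 'cV[Cplx R]_d) (c : R) :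
  norm2 u < 1 -> norm2 v < 1 -> norm2 a < 1 -> kerq u a <= c -> kerq v a <= c ->
  let z := cof 2^-1 0 *: (u + v) in
  norm2 z < 1 /\ kerq z a * (1 + norm2 (u - v) / 4) <= c.
Proof.
move=> u1 v1 a1 hu hv z.
have zE : norm2 z = (norm2 u + norm2 v) / 2 - norm2 (u - v) / 4.
  by rewrite norm2Z norm2D norm2B /abs2 !cE; field.
have nuv := norm2_ge0 (u - v); have nu := norm2_ge0 u; have nv := norm2_ge0 v.
have z1 : norm2 z < 1 by rewrite zE; lra.
split=> //; move: hu hv.
have s0 : 0 < 1 - norm2 a by rewrite subr_gt0.
have c0 : kerq u a <= c -> 0 <= c.
  by move=> h; apply: le_trans h; apply: le_trans (kerq_ge1 u1 a1).
rewrite {1 2}/kerq !ler_pdivrMr ?kerD_gt0 // mulrAC ler_pdivrMr ?kerD_gt0 //.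
move=> hu hv; have {}c0 : 0 <= c by apply: c0; rewrite /kerq ler_pdivrMr ?kerD_gt0.
move: hu hv; rewrite !kerNE /kerD => hu hv.
have hz : hdot z a = cof 2^-1 0 * (hdot u a + hdot v a) by rewrite hdotZl hdotDl.
set k := norm2 (u - v) / 4; have k0 : 0 <= k by rewrite divr_ge0.
have m1 : (1 - re (hdot z a)) ^+ 2 + im (hdot z a) ^+ 2 <=
    c * ((1 - (norm2 u + norm2 v) / 2) * (1 - norm2 a)).
  have e1 : re (hdot z a) = (re (hdot u a) + re (hdot v a)) / 2 by rewrite hz !cE; field.
  have e2 : im (hdot z a) = (im (hdot u a) + im (hdot v a)) / 2 by rewrite hz !cE; field.
  by rewrite e1 e2; exact: sqr_mean_le.
apply: le_trans (_ : c * ((1 - (norm2 u + norm2 v) / 2) * (1 - norm2 a)) * (1 + k) <= _).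
  by rewrite ler_wpM2r // addr_ge0.
rewrite -mulrA ler_wpM2l // mulrAC ler_wpM2r ?(ltW s0) // zE -/k.
have : 0 <= k * (norm2 u + norm2 v) by rewrite mulr_ge0 // addr_ge0.
set A := norm2 u; set B := norm2 v; lra.
Qed.

(** The cross term costs [2 * e] by Cauchy-Schwarz, and the square [e ^+ 2] at most [e]. *)
Lemma norm2_perturb (R : realType) (d : nat) (x y : 'cV[Cplx R]_d) (e : R) :
  norm2 x <= 1 -> 0 <= e <= 1 -> norm2 (x - y) <= e ^+ 2 ->
  norm2 y <= norm2 x + 3 * e.
Proof.
move=> x1 /andP[e0 e1] h; rewrite -[in leLHS](subrKC x y) norm2D.
rewrite norm2_distC in h; set r := re _.
have r2 : r ^+ 2 <= e ^+ 2.
  apply: le_trans (_ : abs2 (hdot x (y - x)) <= _); first by rewrite lerDl sqr_ge0.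
  apply: le_trans (cauchy_schwarz _ _) _.
  apply: le_trans h; rewrite ler_piMl ?norm2_ge0 //.
have re : r <= e.
  apply: le_trans (ler_norm _) _.
  by rewrite -(ler_pXn2r (n := 2)) // ?nnegrE // real_normK ?num_real.
by nra.
Qed.

(** A cluster point of the [u k] is fixed by continuity of [g]; the bound [rho] keeps it inside the
    ball and the constants of [contracts_ball_dist] uniform. *)
Lemma nearly_fixed (R : realType) (d : nat)
    (g : 'cV[Cplx R]_d -> 'cV[Cplx R]_d) (u : nat -> 'cV[Cplx R]_d) (rho : R) :
  contracts_ball g -> 0 <= rho < 1 -> (forall k, norm2 (u k) <= rho) ->
  (forall k, norm2 (u k - g (u k)) <= 4 * k.+1%:R^-1) ->
  exists2 z, norm2 z < 1 & g z = z.
Proof.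
move=> hg /andP[rho0 rho1] ub uf; have [gb _] := hg.
have u1 k : norm2 (u k) < 1 by apply: le_lt_trans (ub k) rho1.
have [z zc] := norm2_cluster ub.
have z1 : norm2 z < 1.
  pose e := (1 - rho) / 4.
  have e0 : 0 < e by rewrite divr_gt0 // subr_gt0.
  have [k _ hk] := zc (e ^+ 2) 0%N (exprn_gt0 2 e0).
  have e1 : 0 <= e <= 1 by rewrite /e; apply/andP; split; lra.
  have := norm2_perturb (ltW (u1 k)) e1 (ltW hk); have := ub k.
  by rewrite /e; lra.
exists z => //; apply/eqP; rewrite -subr_eq0; apply/eqP/norm2_eq0.
apply/eqP; rewrite eq_le norm2_ge0 andbT; apply/ler_addgt0Pr => e e0.
pose K := (1 - norm2 (g z)) * ((1 - rho) * (1 - norm2 z)).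
have K0 : 0 < K by rewrite !mulr_gt0 ?subr_gt0 // gb.
(* Passing from [g z] to [g (u k)], [u k] and [z], with bounds [t / K], [4 * t] and [t] for
   [t = e / s], costs [2 * (t / K) + 2 * (2 * (4 * t) + 2 * t)], which is [e]. *)
pose s := 2 / K + 20.
have s0 : 0 < s by rewrite addr_gt0 // divr_gt0.
have es0 : 0 < e / s by rewrite divr_gt0.
have [N hN] : exists N : nat, N.+1%:R^-1 < e / s.
  exists (Num.truncn (e / s)^-1).
  by rewrite invf_plt ?posrE // truncnS_gt.
have [k Nk hk] := zc (e / s) N es0.
have i1 : norm2 (g z - g (u k)) <= norm2 (u k - z) / K.
  rewrite ler_pdivlMr //; apply: le_trans (contracts_ball_dist hg (u1 k) z1).
  rewrite norm2_distC ler_wpM2l ?norm2_ge0 // /K ler_wpM2l ?subr_ge0 ?(ltW (gb _ _)) //.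
  by rewrite /kerD ler_wpM2r ?subr_ge0 ?(ltW z1) // lerB.
have i2 := norm2_dist_le (g z) (g (u k)) z.
have i3 := norm2_dist_le (g (u k)) (u k) z.
have i4 : norm2 (g (u k) - u k) <= 4 * (e / s).
  rewrite norm2_distC; apply: le_trans (uf k) _; rewrite ler_wpM2l //.
  apply: le_trans (ltW hN); rewrite lef_pV2 ?posrE // ler_nat //.
have i5 : norm2 (u k - z) / K <= (e / s) / K by rewrite ler_pM2r ?invr_gt0 // ltW.
have es : e = (e / s) / K * 2 + 20 * (e / s).
  by rewrite -[LHS](divfK (lt0r_neq0 s0)); move: (e / s) => t; rewrite /s; ring.
by rewrite add0r [leRHS]es; lra.
Qed.

(** * The orbit of the origin: recurrence, records and convergence *)

Lemma orbit_mono (R : realType) (d : nat) (g : 'cV[Cplx R]_d -> 'cV[Cplx R]_d) k z w :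
  contracts_ball g -> norm2 z < 1 -> norm2 w < 1 ->
  kerq (iter k g z) (iter k g w) <= kerq z w.
Proof. by move=> hg z1 w1; have [_] := contracts_ball_iter k hg; apply. Qed.

Lemma orbit_ball (R : realType) (d : nat) (g : 'cV[Cplx R]_d -> 'cV[Cplx R]_d) k :
  contracts_ball g -> norm2 (iter k g 0) < 1.
Proof. by move=> hg; have [h _] := contracts_ball_iter k hg; apply: h; rewrite norm20. Qed.

Lemma kerq_bound (R : realType) (d : nat) (z : 'cV[Cplx R]_d) (c : R) :
  0 < c -> norm2 z < 1 -> (kerq z 0 <= c) = (norm2 z <= 1 - c^-1).
Proof.
move=> c0 z1; rewrite kerq_0r -[c in LHS]invrK lef_pV2 ?posrE ?invr_gt0 ?subr_gt0 //.
by rewrite lerBrDl addrC -lerBrDl.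
Qed.

(* The asymptotic centre argument: among the [c] bounding [kerq u] eventually along
   the orbit for some [u], take one close to the infimum [m]. *)
Lemma bounded_orbit_fixed (R : realType) (d : nat)
    (g : 'cV[Cplx R]_d -> 'cV[Cplx R]_d) (rho : R) :
  contracts_ball g -> rho < 1 -> (forall n, norm2 (iter n g 0) <= rho) ->
  exists2 z, norm2 z < 1 & g z = z.
Proof.
move=> hg rho1 ha; have [gb gq] := hg.
have a1 n : norm2 (iter n g 0) < 1 by exact: orbit_ball.
have r0 : 0 < 1 - rho by rewrite subr_gt0.
have qa n : kerq (iter n g 0) 0 <= (1 - rho)^-1.
  by rewrite kerq_bound ?invr_gt0 // invrK; have := ha n; lra.
pose good (u : 'cV[Cplx R]_d) (c : R) := norm2 u < 1 /\
  exists N : nat, forall n, (N <= n)%N -> kerq u (iter n g 0) <= c.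
pose S := [set c | exists u, good u c].
have S1 c : S c -> 1 <= c.
  by case=> u [u1 [N /(_ N (leqnn N))]]; apply: le_trans; exact: kerq_ge1.
have Sinf : has_inf S.
  split; last by exists 1 => c; exact: S1.
  by exists (1 - rho)^-1; exists 0; split; [rewrite norm20|exists 0%N => n _; rewrite kerqC].
have m1 : 1 <= inf S by apply: lb_le_inf; [case: Sinf|move=> c; exact: S1].
have step (eta : R) : 0 < eta <= 1 -> exists u,
    norm2 u <= 1 - (4 * (inf S + 1) * (1 - rho)^-1)^-1 /\ norm2 (u - g u) <= 4 * eta.
  move=> /andP[eta0 eta1].
  have [c [u [u1 [N hN]]] ceta] := inf_adherent eta0 Sinf.
  exists u; split.
    rewrite -kerq_bound //; last by rewrite !mulr_gt0 ?invr_gt0 //; lra.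
    (* The bound on [u] goes through an orbit point, using [c < inf S + eta <= inf S + 1]; it does
       not depend on [eta]. *)
    apply: le_trans (kerq_triangle u1 (a1 N)) _.
    have := hN N (leqnn N); have := qa N; have := kerq_ge1 u1 (a1 N).
    move=> h1 h2 h3; apply: ler_pM => //.
    - by rewrite mulr_ge0 // (le_trans ler01 h1).
    - by rewrite kerq_0r invr_ge0 subr_ge0 ltW.
    - by rewrite ler_wpM2l //; lra.
  have gu n : (N.+1 <= n)%N -> kerq (g u) (iter n g 0) <= c.
    by case: n => // n Nn; apply: le_trans (gq _ _ u1 (a1 n)) _; exact: hN.
  set de := norm2 (u - g u).
  have de0 : 0 <= de by exact: norm2_ge0.
  have d1 : 0 < 1 + de / 4 by rewrite ltr_wpDr // divr_ge0.
  (* Both [u] and [g u] admit the eventual bound [c], so their midpoint improves it. As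
     [c < inf S + eta] and [1 <= inf S], this forces [de <= 4 * eta]. *)
  have Smid : S (c / (1 + de / 4)).
    exists (cof 2^-1 0 *: (u + g u)); split.
      by have [] := kerq_midpoint u1 (gb _ u1) (a1 N.+1) (hN _ (leqnSn N)) (gu _ (leqnn _)).
    exists N.+1 => n Nn; rewrite ler_pdivlMr //.
    by have [] := kerq_midpoint u1 (gb _ u1) (a1 n) (hN _ (ltnW Nn)) (gu _ Nn).
  have : inf S <= c / (1 + de / 4) by apply: ge_inf => //; case: Sinf.
  rewrite ler_pdivlMr // => h.
  have : inf S * (1 + de / 4) < inf S + eta by apply: le_lt_trans h ceta.
  by nra.
have /choice[u hu] : forall k : nat, exists u,
    norm2 u <= 1 - (4 * (inf S + 1) * (1 - rho)^-1)^-1 /\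
    norm2 (u - g u) <= 4 * k.+1%:R^-1.
  by move=> k; apply: step; rewrite invr_gt0 ltr0Sn invf_le1 ?ltr0Sn // ler1n.
apply: (nearly_fixed hg) (fun k => (hu k).1) (fun k => (hu k).2).
apply/andP; split; first by apply: le_trans (norm2_ge0 _) (hu 0%N).1.
by rewrite gtrBl invr_gt0 !mulr_gt0 ?invr_gt0 //; lra.
Qed.

(* Calka's argument: by compactness, the gaps between consecutive visits of the
   orbit to the region [kerq _ 0 <= 8 * c] are bounded. *)
Lemma recurrent_orbit_bounded (R : realType) (d : nat)
    (g : 'cV[Cplx R]_d -> 'cV[Cplx R]_d) (c : R) :
  contracts_ball g ->
  (forall N : nat, exists2 n, (N <= n)%N & kerq (iter n g 0) 0 <= c) ->
  exists2 rho, rho < 1 & forall n, norm2 (iter n g 0) <= rho.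
Proof.
move=> hg rec; set a := fun n => iter n g 0.
have a1 n : norm2 (a n) < 1 by exact: orbit_ball.
have n01 : norm2 (0 : 'cV[Cplx R]_d) < 1 by rewrite norm20.
have c1 : 1 <= c.
  by have [n _] := rec 0%N; apply: le_trans; exact: kerq_ge1 (a1 n) n01.
(* The factor 8 is the 4 of [kerq_triangle] times the bound 2 in [near2]. *)
pose C := 8 * c; have C0 : 0 < C by rewrite mulr_gt0 //; lra.
pose G n := kerq (a n) 0 <= C.
have [M hM] : exists M : nat, forall n, G n ->
    exists j : nat, [/\ (0 < j)%N, (j <= M)%N & G (n + j)%N].
  apply: contrapT => /forallNP nM.
  have /choice[s hs] : forall M : nat, exists n, G n /\
      forall j : nat, (0 < j)%N -> (j <= M)%N -> ~ G (n + j)%N.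
    move=> M; have /existsNP[n /not_implyP[Gn nj]] := nM M.
    exists n; split=> // j j0 jM Gj; exact: nj (ex_intro _ j (And3 j0 jM Gj)).
  have sB k : norm2 (a (s k)) <= 1 - C^-1 by rewrite -kerq_bound //; exact: (hs k).1.
  have [b bc] := norm2_cluster sB.
  (* Two visits within [e] of [b] are at squared distance at most [4 * e = C ^- 2], which is below
     their [kerD]; so their [kerq] is at most 2. *)
  pose e := (4 * C ^+ 2)^-1; have e0 : 0 < e by rewrite invr_gt0 mulr_gt0 // exprn_gt0.
  have [k0 _ hk0] := bc e 0%N e0.
  (* From [s k0] the orbit returns after [j] steps to the smaller region [kerq _ 0 <= c]. A visit
     [s k] near the same [b] with [k >= j] must follow it into the larger region after [j] steps,
     although its gap exceeds [k]. *)
  have [m mk0 hm] := rec (s k0).+1.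
  pose j := (m - s k0)%N; have j0 : (0 < j)%N by rewrite subn_gt0.
  have [k jk hk] := bc e j e0.
  have [_ hsk] := hs k; apply: (hsk _ j0 jk); rewrite /G.
  have near2 : kerq (a (s k)) (a (s k0)) <= 2.
    apply: le_trans (kerq_near (a1 _) (a1 _)) _.
    have -> : (2 : R) = 1 + 1 by ring.
    rewrite lerD2l ler_pdivrMr ?kerD_gt0 // mul1r.
    have h1 : norm2 (a (s k) - a (s k0)) <= C ^- 2.
      have := norm2_dist_le (a (s k)) b (a (s k0)).
      rewrite (norm2_distC b) => h; apply: le_trans h _.
      have -> : C ^- 2 = 2 * e + 2 * e by rewrite /e; field; rewrite gt_eqF.
      by lra.
    apply: le_trans h1 _; rewrite -exprVn expr2 /kerD.
    apply: ler_pM; rewrite ?invr_ge0 ?(ltW C0) //.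
      by have := sB k; lra.
    by have := sB k0; lra.
  have -> : a (s k + j)%N = iter j g (a (s k)) by rewrite /a addnC iterD.
  have am : a m = iter j g (a (s k0)) by rewrite /a -iterD subnK // ltnW.
  have i1 : norm2 (iter j g (a (s k))) < 1.
    by rewrite /a -iterD; exact: orbit_ball.
  apply: le_trans (kerq_triangle i1 (a1 m)) _.
  have := orbit_mono j hg (a1 (s k)) (a1 (s k0)); rewrite -am => h1.
  have h2 := kerq_ge1 (a1 m) n01.
  have -> : C = 4 * 2 * c by rewrite /C; ring.
  apply: ler_pM => //.
  - by rewrite mulr_ge0 // (le_trans ler01) // kerq_ge1.
  - by rewrite (le_trans ler01).
  - by rewrite ler_wpM2l // (le_trans h1).
have visit n : exists m, [/\ (m <= n)%N, (n <= m + M)%N & G m].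
  elim: n => [|n [m [mn nm Gm]]].
    exists 0%N; split=> //; rewrite /G /a /= kerq_0r norm20 subr0 invr1 /C; lra.
  have [nm'|nm'] := leqP n.+1 (m + M); first by exists m; split=> //; exact: leqW.
  have [j [j0 jM Gj]] := hM m Gm.
  have nE : n = (m + M)%N by apply/eqP; rewrite eqn_leq nm -ltnS nm'.
  exists (m + j)%N; split=> //.
    by rewrite nE ltnW // ltnS leq_add2l.
  by rewrite nE -addnS -addnA leq_add2l -add1n leq_add2r.
(* Any [a n] is at most [M] steps after a visit [a m]; it is compared with [a (n - m)], which is
   among these first [M.+1] points. *)
pose K := \sum_(i < M.+1) kerq (a i) 0.
have K1 i : (i <= M)%N -> kerq (a i) 0 <= K.
  move=> iM; rewrite /K (bigD1 (Ordinal (iM : (i < M.+1)%N))) //= lerDl sumr_ge0 // => l _.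
  by rewrite (le_trans ler01) // kerq_ge1.
have K0 : 1 <= K by apply: le_trans (K1 0%N isT); rewrite kerq_ge1.
have den0 : 0 < 4 * C * K by rewrite !mulr_gt0 //; lra.
exists (1 - (4 * C * K)^-1); first by rewrite gtrBl invr_gt0.
move=> n; have [m [mn nm Gm]] := visit n.
rewrite -(kerq_bound den0) ?orbit_ball //.
set i := (n - m)%N; have iM : (i <= M)%N by rewrite leq_subLR.
have -> : iter n g 0 = iter i g (a m) by rewrite /a -iterD subnK.
have i1 : norm2 (iter i g (a m)) < 1 by rewrite /a -iterD; exact: orbit_ball.
apply: le_trans (kerq_triangle i1 (a1 i)) _.
have h1 := orbit_mono i hg (a1 m) n01.
have h2 := kerq_ge1 (a1 i) n01.
apply: ler_pM.
- by rewrite mulr_ge0 // (le_trans ler01) // kerq_ge1.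
- by rewrite (le_trans ler01).
- by rewrite ler_wpM2l // (le_trans h1).
- exact: K1.
Qed.

Lemma orbit_to_boundary (R : realType) (d : nat)
    (g : 'cV[Cplx R]_d -> 'cV[Cplx R]_d) (rho : R) :
  contracts_ball g -> (forall z, norm2 z < 1 -> g z <> z) -> rho < 1 ->
  exists N : nat, forall n, (N <= n)%N -> rho < norm2 (iter n g 0).
Proof.
move=> hg gf rho1; apply: contrapT => /forallNP nN.
have r0 : 0 < 1 - rho by rewrite subr_gt0.
have [N|rho' rho'1 hb] := @recurrent_orbit_bounded _ _ g (1 - rho)^-1 hg.
  have /existsNP[n /not_implyP[Nn /negP]] := nN N.
  rewrite -leNgt => h; exists n => //.
  by rewrite kerq_bound ?invr_gt0 ?orbit_ball // invrK; lra.
have [z z1 gz] := bounded_orbit_fixed hg rho'1 hb.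
exact: gf gz.
Qed.

(* At a record time [n >= j], [kerq (a j) (a n) <= kerq 0 (a (n - j)) <= kerq 0 (a n)]
   holds for the orbit [a], that is, [kerN (a j) (a n) <= 1 - norm2 (a j)]. *)
Lemma orbit_record (R : realType) (d : nat)
    (g : 'cV[Cplx R]_d -> 'cV[Cplx R]_d) (j n : nat) :
  contracts_ball g -> (j <= n)%N ->
  (forall m, (m <= n)%N -> norm2 (iter m g 0) <= norm2 (iter n g 0)) ->
  norm2 (iter j g 0 - iter n g 0) <= 2 * Num.sqrt (1 - norm2 (iter j g 0)).
Proof.
move=> hg jn hn; set a := fun n => iter n g 0.
have a1 m : norm2 (a m) < 1 by exact: orbit_ball.
have n01 : norm2 (0 : 'cV[Cplx R]_d) < 1 by rewrite norm20.
have := orbit_mono j hg n01 (a1 (n - j)%N).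
rewrite /a -iterD subnKC // -/(a j) -/(a n) -/(a (n - j)%N) [leRHS]kerqC kerq_0r => h.
have {}h : kerq (a j) (a n) <= (1 - norm2 (a n))^-1.
  apply: le_trans h _; rewrite lef_pV2 ?posrE ?subr_gt0 // lerD2l lerN2.
  by apply: hn; exact: leq_subr.
move: h; rewrite /kerq ler_pdivrMr ?kerD_gt0 // /kerD mulrC mulfK; last first.
  by rewrite gt_eqF // subr_gt0.
rewrite kerNE norm2B => h.
set x := 1 - norm2 (a j) in h *; have x0 : 0 <= x by rewrite subr_ge0 ltW.
set p := re _ in h *.
(* Both points being in the ball, their squared distance is less than [2 * (1 - p)]. *)
have p1 : 1 - p <= Num.sqrt x.
  apply: le_trans (ler_norm _) _; rewrite -sqrtr_sqr ler_sqrt //.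
  by apply: le_trans h; rewrite lerDl sqr_ge0.
have := a1 j; have := a1 n; lra.
Qed.

Lemma wolff (R : realType) (d : nat) (g : 'cV[Cplx R]_d -> 'cV[Cplx R]_d) :
  contracts_ball g -> (forall z, norm2 z < 1 -> g z <> z) ->
  exists2 zeta, norm2 zeta = 1 & forall e, 0 < e ->
    exists N : nat, forall n, (N <= n)%N -> norm2 (iter n g 0 - zeta) < e.
Proof.
move=> hg gf; set a := fun n => iter n g 0.
have a1 m : norm2 (a m) < 1 by exact: orbit_ball.
have record K : exists n, (K <= n)%N /\
    forall m, (m <= n)%N -> norm2 (a m) <= norm2 (a n).
  (* The first time the orbit exceeds its maximum up to time [K] is a record. *)
  pose M := \big[Num.max/0]_(i < K.+1) norm2 (a i).
  have M1 : M < 1 by apply/bigmax_ltP; split=> // i _; exact: a1.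
  have leM i : (i <= K)%N -> norm2 (a i) <= M.
    by move=> iK; apply: (le_bigmax _ (fun i : 'I_K.+1 => norm2 (a i)) (Ordinal (_ : i < K.+1)%N)).
  have ex : exists n, M < norm2 (a n).
    by have [N hN] := orbit_to_boundary hg gf M1; exists N; exact: hN.
  have [n Mn least] := ex_minnP ex; exists n.
  have Kn : (K < n)%N by rewrite ltnNge; apply/negP => /leM; rewrite leNgt Mn.
  split=> [|m]; first exact: ltnW.
  rewrite leq_eqVlt => /predU1P[->//|mn]; apply: ltW; apply: le_lt_trans Mn.
  by rewrite leNgt; apply/negP => /least; rewrite leqNgt mn.
have /choice[s hs] := record.
have sB k : norm2 (a (s k)) <= 1 by exact: ltW.
have [zeta zc] := norm2_cluster sB.
have near (e : R) : 0 < e -> exists N : nat, forall n, (N <= n)%N ->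
    norm2 (a n - zeta) <= 6 * e /\ 1 - e ^+ 2 < norm2 (a n).
  move=> e0; have e2 : 1 - e ^+ 2 < 1 by rewrite gtrBl exprn_gt0.
  have [N hN] := orbit_to_boundary hg gf e2.
  exists N => n Nn; split; last exact: hN.
  (* A record time [s k >= n] with [a (s k)] near [zeta]: the bounds [2 * e] and [e] combine to
     [2 * (2 * e) + 2 * e]. *)
  have [k nk hk] := zc e n e0.
  have n_sk : (n <= s k)%N by apply: leq_trans nk (hs k).1.
  have h1 := orbit_record hg n_sk (hs k).2.
  have h2 : Num.sqrt (1 - norm2 (a n)) <= e.
    rewrite -(ger0_norm (ltW e0)) -sqrtr_sqr ler_sqrt ?sqr_ge0 //.
    by have := hN n Nn; rewrite -/(a n); lra.
  have := norm2_dist_le (a n) (a (s k)) zeta.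
  by rewrite -/(a n) -/(a (s k)) in h1; lra.
exists zeta; last first.
  move=> e e0; have e7 : 0 < e / 7 by rewrite divr_gt0.
  have [N hN] := near _ e7; exists N => n /hN[h _]; rewrite -/(a n); lra.
have close e : 0 < e <= 1 -> exists n, norm2 (a n - zeta) <= e ^+ 2 /\ 1 - e <= norm2 (a n).
  move=> /andP[e0 e1]; have e6 : 0 < e ^+ 2 / 6 by rewrite divr_gt0 // exprn_gt0.
  have [N /(_ N (leqnn N))[h1 h2]] := near _ e6; exists N; split; first lra.
  apply: le_trans (ltW h2); rewrite lerD2l lerN2.
  have : e ^+ 2 <= 1 by rewrite expr_le1 // ltW.
  have : e ^+ 2 <= e by rewrite expr2 ler_piMl // ltW.
  by have := sqr_ge0 e; nra.
have zeta1 : norm2 zeta <= 1.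
  apply/ler_addgt0Pr => e e0; pose t := Num.min (e / 3) 1.
  have t01 : 0 < t <= 1 by rewrite /t lt_min ltr01 andbT divr_gt0 //= ge_min lexx orbT.
  have te : t <= e / 3 by rewrite /t ge_min lexx.
  have [n [h1 _]] := close _ t01; have /andP[/ltW t0 t1] := t01.
  have t01' : 0 <= t <= 1 by rewrite t0.
  by have := norm2_perturb (ltW (a1 n)) t01' h1; have := a1 n; lra.
apply/eqP; rewrite eq_le zeta1 /=.
(* One [t] is lost in [1 - t <= norm2 (a n)], three in [norm2_perturb]. *)
apply/ler_addgt0Pr => e e0; pose t := Num.min (e / 4) 1.
have t01 : 0 < t <= 1 by rewrite /t lt_min ltr01 andbT divr_gt0 //= ge_min lexx orbT.
have te : t <= e / 4 by rewrite /t ge_min lexx.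
have [n [h1 h2]] := close _ t01; have /andP[/ltW t0 t1] := t01.
have t01' : 0 <= t <= 1 by rewrite t0.
rewrite norm2_distC in h1.
by have := norm2_perturb zeta1 t01' h1; lra.
Qed.

(** * From the orbit at level 1 to all levels *)

Lemma l2norm_lt (R : realType) (n : nat) (v : 'cV[Cplx R]_n) (e : R) :
  0 < e -> (l2norm v < e) = (norm2 v < e ^+ 2).
Proof.
by move=> e0; rewrite l2normE -{1}(ger0_norm (ltW e0)) -sqrtr_sqr ltr_sqrt // exprn_gt0.
Qed.

Lemma unit_ball_norm2 (R : realType) (n : nat) (v : 'cV[Cplx R]_n) :
  unit_ball v <-> norm2 v < 1.
Proof. by rewrite /unit_ball /= l2norm_lt // expr1n. Qed.

Lemma level1_contracts (R : realType) (d : nat) (f : graded_map R d) :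
  nc_selfmap f -> contracts_ball (level1 f).
Proof.
move=> hf; have [fb _ _] := hf.
have gb z : norm2 z < 1 -> norm2 (level1 f z) < 1.
  move=> /const_tuple_rowball z1; apply/const_tuple_rowball.
  by rewrite -const_tuple_level1; exact: fb.
split=> // z w z1 w1.
rewrite /kerq ler_pdivrMr ?kerD_gt0 ?gb // mulrAC ler_pdivlMr ?kerD_gt0 //.
exact: schwarz_pick.
Qed.

Lemma closed_rowball_rowball (R : realType) (d n : nat) (r : R) (X : mxtuple R d n) :
  r < 1 -> closed_rowball r X -> rowball X.
Proof. by move=> r1 [n0 Xr]; split=> //; exact: le_lt_trans Xr r1. Qed.

(** With [w = 0] the lower coordinate drops out of the form, and Cauchy-Schwarz bounds the corner by
    [c ^+ 2] times the form of [X]. *)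
Lemma shear0_rowball (R : realType) (d n : nat) (X : mxtuple R d n)
    (x : 'cV[Cplx R]_n) (r c : R) :
  closed_rowball r X -> norm2 x = 1 -> r ^+ 2 * (1 + c ^+ 2) < 1 ->
  rowball (shear (cof c 0 *: x) X (const_tuple 0 1)).
Proof.
move=> [n0 Xr] x1 rc; split; first by rewrite addn_gt0 n0.
apply: rownorm_lt1 rc _ => y; rewrite -[y]vsubmxK [dsubmx y]mx11_scalar.
rewrite rowform_shear_const scaler0 addr0 norm2_col.
set u := usubmx y; set eta := dsubmx y 0 0.
have hX : rowform X u <= r ^+ 2 * norm2 u.
  apply: le_trans (rowform_rownorm X u) _; rewrite ler_wpM2r ?norm2_ge0 //.
  by rewrite lerXn2r // nnegrE ?rownorm_ge0 // (le_trans (rownorm_ge0 X)).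
have hT : norm2 (\col_j hdot (X j *m (cof c 0 *: x)) u) <= c ^+ 2 * rowform X u.
  rewrite norm2E /rowform mulr_sumr; apply: ler_sum => j _.
  rewrite mxE hdot_mulmx; apply: le_trans (cauchy_schwarz _ _) _.
  by rewrite norm2Z x1 mulr1 /abs2 re_cof im_cof expr0n /= addr0.
apply: le_trans (_ : (1 + c ^+ 2) * rowform X u <= _).
  by rewrite mulrDl mul1r lerD2l.
have r0 : 0 <= r by exact: le_trans (rownorm_ge0 X) Xr.
have c1 : 0 <= 1 + c ^+ 2 by rewrite addr_ge0 ?sqr_ge0.
apply: le_trans (_ : (1 + c ^+ 2) * (r ^+ 2 * norm2 u) <= _); first by rewrite ler_wpM2l.
rewrite mulrA [_ * r ^+ 2]mulrC ler_wpM2l ?mulr_ge0 ?sqr_ge0 //.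
by rewrite lerDl norm2_ge0.
Qed.

(* The Schwarz-Pick inequality between [X] and [0], tested on a unit vector [x]: for
   [A := f n X] and [a := f 0], the argument of [abs2] is
   [1 - hdot (\sum_j conj a_j A_j x) x]. *)
Lemma nc_schwarz_pick0 (R : realType) (d n : nat) (f : graded_map R d)
    (X : mxtuple R d n) (x : 'cV[Cplx R]_n) (r c : R) :
  nc_selfmap f -> r < 1 -> closed_rowball r X -> norm2 x = 1 ->
  r ^+ 2 * (1 + c ^+ 2) < 1 ->
  c ^+ 2 * abs2 (1 - hdot (\col_j hdot (f n X j *m x) x) (level1 f 0)) <=
  2 * (1 + c ^+ 2) * (1 - norm2 (level1 f 0)).
Proof.
move=> hf r1 Xr x1 rc; set a := level1 f 0; set e := 1 - _; have [fb _ _] := hf.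
have bX := closed_rowball_rowball r1 Xr.
have b0 : rowball (const_tuple (0 : 'cV[Cplx R]_d) 1).
  by apply/const_tuple_rowball; rewrite norm20.
have bP := nc_shear hf bX b0 (shear0_rowball Xr x1 rc).
rewrite const_tuple_level1 -/a in bP.
have a1 : norm2 a < 1.
  by apply/const_tuple_rowball; rewrite -const_tuple_level1; exact: fb.
set s := 1 - norm2 a; have s0 : 0 < s by rewrite subr_gt0.
have s1 : s <= 1 by rewrite gerBl norm2_ge0.
(* The choice of [y] makes [hdot T a] equal to its conjugate. Cauchy-Schwarz against [a] then gives
   [abs2 y <= (1 + abs2 y) * (1 - s)], whence [abs2 k <= s]. *)
pose k := cof c 0 * (cof s 0 - e).
pose y := Num.conj (cof s^-1 0 * k).
have := rowball_form_le (col_mx x y%:M) bP.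
rewrite rowform_shear_const norm2_col norm2_1 x1.
set T := _ + _ *: a => hT.
have {}hT : norm2 T <= 1 + abs2 y by apply: le_trans hT; rewrite lerDr rowform_ge0.
have hTa : hdot T a = cof s^-1 0 * k.
  have -> : T = cof c 0 *: (\col_j hdot (f n X j *m x) x) + (cof s^-1 0 * k - cof c 0) *: a.
    rewrite /T /y conjCK hdotZl; congr (_ + (_ - _) *: _).
      by apply/matrixP => i l; rewrite !mxE -scalemxAr hdotZl.
    rewrite (_ : hdot x x = 1) ?mulr1 //.
    by apply: cplxP; [rewrite -[LHS]/(norm2 x) x1|exact: im_hdot].
  rewrite hdotDl !hdotZl (_ : hdot (\col_j _) a = 1 - e); last first.
    by rewrite /e opprB addrCA subrr addr0.
  have -> : hdot a a = cof (1 - s) 0.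
    by apply: cplxP; rewrite ?im_hdot // re_cof /s /norm2; ring.
  by apply: cplxP; rewrite /k !cE; field; rewrite gt_eqF.
have ks : abs2 k <= s.
  have := cauchy_schwarz T a; rewrite hTa.
  have -> : abs2 (cof s^-1 0 * k) = abs2 k / s ^+ 2 by rewrite /abs2 !cE; field; rewrite gt_eqF.
  have yE : abs2 y = abs2 k / s ^+ 2 by rewrite /y /abs2 !cE; field; rewrite gt_eqF.
  rewrite yE in hT => h.
  have na : norm2 a = 1 - s by rewrite /s; ring.
  have {}h : abs2 k / s ^+ 2 <= (1 + abs2 k / s ^+ 2) * (1 - s).
    by apply: le_trans h _; rewrite na ler_wpM2r // -na norm2_ge0.
  have {}h : abs2 k / s ^+ 2 * s <= 1 - s by lra.
  move: h; rewrite (_ : _ * s = abs2 k / s); last by field; rewrite gt_eqF.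
  by rewrite ler_pdivrMr //; have := mulr_ge0 (ltW s0) (ltW s0); lra.
have -> : c ^+ 2 * abs2 e = abs2 (cof c 0 * cof s 0 - k) by rewrite /k /abs2 !cE; ring.
have h1 : abs2 (cof c 0 * cof s 0 - k) <= 2 * (c ^+ 2 * s ^+ 2) + 2 * abs2 k.
  rewrite -subr_ge0 (_ : _ - _ = abs2 (cof c 0 * cof s 0 + k)) ?abs2_ge0 //.
  by rewrite /abs2 !cE; ring.
have h2 : c ^+ 2 * s ^+ 2 <= c ^+ 2 * s.
  by rewrite ler_wpM2l ?sqr_ge0 // expr2 ler_piMl // ltW.
by lra.
Qed.

Lemma level1_iterE (R : realType) (d : nat) (f : graded_map R d) k z :
  level1 (fun n => iter k (f n)) z = iter k (level1 f) z.
Proof.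
by apply: const_tuple_inj; rewrite level1_iter -(const_tuple_level1 (fun n => iter k (f n))).
Qed.

Lemma level1_fixed_point_free (R : realType) (d : nat) (f : graded_map R d) :
  fixed_point_free f -> forall z, norm2 z < 1 -> level1 f z <> z.
Proof.
move=> ff z z1 fz; have /const_tuple_rowball bz := z1.
by apply: ff bz _; rewrite const_tuple_level1 fz.
Qed.

Lemma rowformD_le (R : realType) (d n : nat) (X Y : mxtuple R d n) x :
  rowform (X + Y) x <= 2 * rowform X x + 2 * rowform Y x.
Proof.
rewrite /rowform !mulr_sumr -big_split; apply: ler_sum => j _ /=.
by rewrite ffunE linearD /= map_mxD mulmxDl norm2D_le.
Qed.

Lemma const_tupleB (R : realType) (d n : nat) (z w : 'cV[Cplx R]_d) :
  const_tuple z n - const_tuple w n = const_tuple (z - w) n.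
Proof. by apply/ffunP => j; rewrite !ffunE !mxE raddfB. Qed.

(** As [f n X] and [level1 f 0] are in their balls, [rowform_dist_const] is at most
    [2 * (1 - re h)], and [nc_schwarz_pick0] controls [1 - h]. *)
Lemma nc_dist_level1 (R : realType) (d n : nat) (f : graded_map R d)
    (X : mxtuple R d n) (x : 'cV[Cplx R]_n) (r c : R) :
  nc_selfmap f -> r < 1 -> closed_rowball r X -> norm2 x = 1 ->
  0 < c -> r ^+ 2 * (1 + c ^+ 2) < 1 ->
  rowform (f n X - const_tuple (level1 f 0) n) x <=
  2 * Num.sqrt (2 * (1 + c ^+ 2) / c ^+ 2 * (1 - norm2 (level1 f 0))).
Proof.
move=> hf r1 Xr x1 c0 rc; have [fb _ _] := hf.
have bX := closed_rowball_rowball r1 Xr.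
have := nc_schwarz_pick0 hf r1 Xr x1 rc.
rewrite rowform_dist_const x1 mulr1; set h := hdot _ _; set a := level1 f 0 => hc.
have a1 : norm2 a < 1.
  apply/const_tuple_rowball; rewrite -const_tuple_level1; apply: fb.
  by apply/const_tuple_rowball; rewrite norm20.
have hA : rowform (f n X) x <= 1 by rewrite -x1; apply: rowball_form_le; exact: fb.
have h1 : 1 - re h <= Num.sqrt (2 * (1 + c ^+ 2) / c ^+ 2 * (1 - norm2 a)).
  apply: le_trans (ler_norm _) _; rewrite -sqrtr_sqr ler_sqrt; last first.
    by rewrite mulr_ge0 ?subr_ge0 ?(ltW a1) // divr_ge0 ?sqr_ge0 // mulr_ge0 // addr_ge0 ?sqr_ge0.
  rewrite mulrAC ler_pdivlMr ?exprn_gt0 // mulrC; apply: le_trans hc.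
  by rewrite ler_wpM2l ?sqr_ge0 // /abs2 !cE lerDl sqr_ge0.
lra.
Qed.

(** * Compact sets, uniform convergence and the Denjoy-Wolff point *)

Lemma compact_unit_ball (R : realType) (d : nat) (K : set 'cV[Cplx R]_d) :
  compact K -> K `<=` @unit_ball R d ->
  exists2 r : R, 0 < r < 1 & forall z, K z -> norm2 z <= r ^+ 2.
Proof.
move=> cK Kb; apply: contrapT => nr.
(* Starting at [k.+2] keeps [1 - k.+2%:R^-1], and with it the excluded radius, positive. *)
have /choice[u hu] : forall k : nat, exists z, K z /\ 1 - k.+2%:R^-1 < norm2 z.
  move=> k; apply: contrapT => /forallNP nz; apply: nr.
  have k1 : 0 < k.+2%:R^-1 :> R by rewrite invr_gt0.
  have k2 : k.+2%:R^-1 < 1 :> R by rewrite invf_lt1 // ltr1n.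
  exists (Num.sqrt (1 - k.+2%:R^-1)).
    by rewrite sqrtr_gt0 subr_gt0 k2 -[ltRHS]sqrtr1 ltr_sqrt // gtrBl.
  move=> z Kz; rewrite sqr_sqrtr ?subr_ge0 ?(ltW k2) // leNgt; apply/negP => hz.
  by apply: (nz z).
have [|p [Kp pc]] := cK (u @ \oo) (fmap_proper_filter u _).
  by exists 0%N => // n _; exact: (hu n).1.
have p1 : norm2 p < 1 by apply/unit_ball_norm2; exact: Kb.
(* For late [n] with [u n] near [p], [1 - e < norm2 (u n) <= norm2 p + 3 * e], against
   [8 * e = 1 - norm2 p]. *)
pose e := (1 - norm2 p) / 8.
have e0 : 0 < e by rewrite divr_gt0 // subr_gt0.
have e1 : 0 <= e <= 1 by have := norm2_ge0 p; rewrite /e; lra.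
have e20 : 0 < e ^+ 2 by rewrite exprn_gt0.
pose h := Num.sqrt (e ^+ 2 / (d%:R + 1)).
have den0 : 0 < d%:R + 1 :> R by rewrite ltr_wpDl.
have h2 : h ^+ 2 = e ^+ 2 / (d%:R + 1) by rewrite sqr_sqrtr // divr_ge0 // ltW.
have h0 : 0 < h by rewrite sqrtr_gt0 divr_gt0.
(* Radii of balls over [Cplx R] are themselves elements of [Cplx R]. *)
have hC : 0 < (cof h 0 : Cplx R) by rewrite ltcE /= eqxx.
have [N hN] : exists N : nat, N.+2%:R^-1 < e.
  exists (Num.truncn e^-1); rewrite invf_plt ?posrE //.
  by apply: lt_trans (truncnS_gt _) _; rewrite ltr_nat.
have [|_ [[n Nn <-] pn]] := pc [set u n | n in [set n | (N <= n)%N]] (ball p (cof h 0)) _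
    (nbhsx_ballx p _ hC).
  by exists N => // n /= Nn; exists n.
case: pn => _ pn.
have dist : norm2 (p - u n) <= e ^+ 2.
  apply: le_trans (_ : d%:R * h ^+ 2 <= _); last first.
    by rewrite h2 mulrA ler_pdivrMr // mulrC mulrDr mulr1 lerDl ltW.
  rewrite norm2E; have -> : d%:R * h ^+ 2 = \sum_(j < d) h ^+ 2.
    by rewrite sumr_const card_ord mulr_natl.
  apply: ler_sum => j _; have := pn j 0; rewrite -ball_normE /= normc_def => hj.
  have {}hj : Num.sqrt (abs2 (p j 0 - u n j 0)) < h by move: hj; rewrite ltcR.
  rewrite !mxE -(sqr_sqrtr (abs2_ge0 _)) lerXn2r ?nnegrE ?sqrtr_ge0 // ltW //.
have := norm2_perturb (ltW p1) e1 dist; have [_ hn] := hu n.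
have : n.+2%:R^-1 < e.
  by apply: le_lt_trans hN; rewrite lef_pV2 ?posrE // ler_nat.
rewrite /e in hn *; set q := _^-1 in hn *; set t := norm2 p; lra.
Qed.

Lemma rownorm_const1 (R : realType) (d : nat) (z : 'cV[Cplx R]_d) :
  l2norm z <= rownorm (const_tuple z 1).
Proof.
have := rowform_rownorm (const_tuple z 1) 1%:M.
rewrite const_tuple_form norm2_1 {1 2}/abs2 re1 im1 expr0n expr1n /= addr0 !mulr1 => h.
rewrite l2normE -(ger0_norm (rownorm_ge0 _)) -sqrtr_sqr ler_sqrt ?sqr_ge0 //.
Qed.

(** The [k]-th iterate is itself an nc self-map [F], so [nc_dist_level1] applies to [F] at [X]: the
    radius [r], and hence [c] and [M], stay the same for all [k] and all levels. *)
Lemma iterates_subball (R : realType) (d : nat) (f : graded_map R d)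
    (zeta : 'cV[Cplx R]_d) (r : R) :
  nc_selfmap f -> fixed_point_free f -> 0 < r < 1 ->
  (forall e, 0 < e -> exists N : nat, forall n, (N <= n)%N ->
     norm2 (iter n (level1 f) 0 - zeta) < e) ->
  iterates_cvg_subball f zeta r.
Proof.
move=> hf ff /andP[r0 r1] hz eps eps0.
pose c := Num.sqrt ((1 - r ^+ 2) / 2).
have rr : r ^+ 2 < 1 by rewrite expr_lt1 // ltW.
have c0 : 0 < c by rewrite sqrtr_gt0 divr_gt0 // subr_gt0.
have c2 : c ^+ 2 = (1 - r ^+ 2) / 2 by rewrite sqr_sqrtr // divr_ge0 // subr_ge0 ltW.
have rc : r ^+ 2 * (1 + c ^+ 2) < 1.
  by rewrite c2; have := sqr_ge0 r; set q := r ^+ 2 in rr *; nra.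
pose M := 2 * (1 + c ^+ 2) / c ^+ 2.
have M0 : 0 < M by rewrite divr_gt0 ?exprn_gt0 // mulr_gt0 // ltr_wpDr ?sqr_ge0.
(* The form is at most [2 * (2 * (eps ^+ 2 / 32)) + 2 * (eps ^+ 2 / 16)], which is
   [(eps / 2) ^+ 2]. *)
have e0 : 0 < eps ^+ 2 / 32 by rewrite divr_gt0 // exprn_gt0.
have e16 : 0 < eps ^+ 2 / 16 by rewrite divr_gt0 // exprn_gt0.
have [N1 hN1] := hz _ e16.
have rho1 : 1 - (eps ^+ 2 / 32) ^+ 2 / M < 1 by rewrite gtrBl divr_gt0 // exprn_gt0.
have [N2 hN2] := orbit_to_boundary (level1_contracts hf) (level1_fixed_point_free ff) rho1.
exists (maxn N1 N2) => k; rewrite geq_max => /andP[kN1 kN2] n X Xr.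
have := hN1 k kN1; have := hN2 k kN2; rewrite -(level1_iterE f).
set F : graded_map R d := fun n => iter k (f n); set a := level1 F 0 => ha hza.
have hF : nc_selfmap F by exact: nc_selfmap_iter.
have sM : Num.sqrt (M * (1 - norm2 a)) <= eps ^+ 2 / 32.
  rewrite -(ger0_norm (ltW e0)) -sqrtr_sqr ler_sqrt ?sqr_ge0 //.
  by rewrite mulrC -ler_pdivlMr //; lra.
have e4 : 0 <= eps ^+ 2 / 4 by rewrite divr_ge0 ?sqr_ge0.
apply: le_lt_trans (rownorm_le e4 _) _; last first.
  rewrite (_ : _ / 4 = (eps / 2) ^+ 2); last by field.
  by rewrite sqrtr_sqr ger0_norm ?divr_ge0 ?(ltW eps0) // ltr_pdivrMr // mulr_natr mulr2n ltrDl.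
move=> x x1.
have -> : iter k (f n) X - const_tuple zeta n =
    (F n X - const_tuple a n) + const_tuple (a - zeta) n.
  by rewrite -const_tupleB addrA subrK.
apply: le_trans (rowformD_le _ _ _) _.
have := nc_dist_level1 hF r1 Xr x1 c0 rc; rewrite -/M -/a const_tuple_form x1 mulr1.
lra.
Qed.

Theorem theorem4p4 (R : realType) (d : nat) (f : graded_map R d)
    (f_nc : nc_selfmap f) (f_free : fixed_point_free f) :
  exists zeta : 'cV[Cplx R]_d,
    Denjoy_Wolff_point (level1 f) zeta /\
    forall r : R, 0 < r -> r < 1 -> iterates_cvg_subball f zeta r.
Proof.
have [zeta zeta1 hz] := wolff (level1_contracts f_nc) (level1_fixed_point_free f_free).
have sub r : 0 < r -> r < 1 -> iterates_cvg_subball f zeta r.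
  by move=> r0 r1; apply: iterates_subball => //; rewrite r0.
exists zeta; split=> //; split.
  split; first by rewrite /unit_sphere /= l2normE zeta1 sqrtr1.
  move=> K cK Kb eps eps0.
  (* Convergence on compact sets is read off at level 1 of a subball containing [K]. *)
  have [r /andP[r0 r1] Kr] := compact_unit_ball cK Kb.
  have [N hN] := sub r r0 r1 eps eps0; exists N => k kN z Kz.
  apply: le_lt_trans (rownorm_const1 _) _.
  rewrite -const_tupleB level1_iter; apply: hN => //; split=> //.
  apply: le_trans (rownorm_const_le _ _) _.
  by rewrite l2normE -(ger0_norm (ltW r0)) -sqrtr_sqr ler_sqrt ?sqr_ge0 // Kr.
(* Uniqueness: tested on the compact set [[set 0]], any other candidate is also a limit of the orbit
   of 0. *)
move=> y [_ hy]; apply/eqP; rewrite -subr_eq0; apply/eqP/norm2_eq0.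
apply/eqP; rewrite eq_le norm2_ge0 andbT; apply/ler_addgt0Pr => e e0.
have e4 : 0 < e / 4 by rewrite divr_gt0.
have s4 : 0 < Num.sqrt (e / 4) by rewrite sqrtr_gt0.
have [N1 hN1] := hz _ e4.
have [|N2 hN2] := hy [set 0] (@compact_set1 _ _) _ _ s4.
  by move=> _ ->; apply/unit_ball_norm2; rewrite norm20.
have h1 := hN1 _ (leq_maxl N1 N2).
have := hN2 _ (leq_maxr N1 N2) 0 erefl; rewrite l2norm_lt // sqr_sqrtr ?(ltW e4) // => h2.
have := norm2_dist_le zeta (iter (maxn N1 N2) (level1 f) 0) y.
by rewrite (norm2_distC zeta (iter _ _ _)) add0r; lra.
Qed.
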